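(* Let $(G,\rho,V)$ be a prehomogeneous vector space with open orbit $\Omega$, and let $v_0\in\Omega$. Let $f_1,\ldots,f_r$ be a set of basic relative invariants. Let $\Phi_1,\ldots,\Phi_s$ be a basis of $\mathscr{A}_1(G)$, and for $1\leq i\leq s$ let $\frac{h_i}{g_i}$ be an additive relative invariant, written in lowest terms, with corresponding additive function $\Phi_i$. For $1\le i\le r$ let $v_i\in V(f_i)$ with $v_i\notin V(f_j)$ for all $j\neq i$. Then: (1) Each $f_i$ is invariant under the action of $[G,G]\cdot G_{v_0}$, and of $G_{v_j}$ for $j\neq i$. (2) Each $h_i$ is invariant under the action of $[G,G]\cdot G_{v_0}$, and of $G_{v_j}$ for $j$ with $g_i(v_j)\neq 0$. (3) The polynomials $f_1,\ldots,f_r,h_1,\ldots,h_s\in\mathbb{C}[V]$ are algebraically independent over $\mathbb{C}$.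
   Context: A prehomogeneous vector space $(G,\rho,V)$ is a rational representation $\rho:G\to\mathrm{GL}(V)$ of a connected complex linear algebraic group $G$ on a finite-dimensional complex vector space $V$ having a (unique) Zariski open orbit $\Omega\subseteq V$. $G_v$ is the isotropy subgroup of $G$ at $v$; $V(f)$ is the zero set of $f$. The basic relative invariants are the irreducible polynomials defining the distinct irreducible hypersurface components of $V\setminus\Omega$. An additive relative invariant is a rational function $h$ on $V$ for which there is a homomorphism of algebraic groups (additive function) $\Phi:G\to\mathbb{G}_a=(\mathbb{C},+)$ with $h(\rho(g)(v))-h(v)=\Phi(g)$ for all $v\in\Omega$, $g\in G$; then $\Phi$ is the additive function corresponding to $h$. $\mathscr{A}_1(G)$ is the (finite-dimensional) complex vector space of all additive functions $\Phi$ of $G$ that correspond to some additive relative invariant. *)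

(* Defs.v *)
From mathcomp Require Export all_boot all_order all_algebra fraction.
From mathcomp Require Export classical_sets reals complex mpoly.

Set Implicit Arguments.
Unset Strict Implicit.
Unset Printing Implicit Defensive.

Import GRing.Theory.

Local Open Scope ring_scope.
Local Open Scope classical_set_scope.

(* Linear algebraic groups are Zariski closed subgroups G of some GL_m(F),     *)
(* given as sets of m x m matrices. Functions on G, including representations *)
(* of G, are functions on all of 'M_m whose values outside G are irrelevant.  *)

Definition mx_zariski_closed (F : fieldType) (m : nat) (Z : set 'M[F]_m) :
    Prop :=
  exists I : set {mpoly F[m * m]},
    Z = [set A | forall p, I p -> p.@[mxvec A ord0] = 0].

Definition mx_group (F : fieldType) (m : nat) (G : set 'M[F]_m) : Prop :=
  [/\ G `<=` [set A | A \in unitmx],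
      G 1%:M,
      forall A B, G A -> G B -> G (A *m B)
    & forall A, G A -> G (invmx A)].

Definition linear_algebraic_group (F : fieldType) (m : nat)
    (G : set 'M[F]_m) : Prop :=
  mx_group G /\
  exists2 Z, mx_zariski_closed Z & G = Z `&` [set A | A \in unitmx].

Definition zariski_connected (F : fieldType) (m : nat) (G : set 'M[F]_m) :
    Prop :=
  forall Z1 Z2 : set 'M[F]_m, mx_zariski_closed Z1 -> mx_zariski_closed Z2 ->
    G `<=` Z1 `|` Z2 -> G `&` Z1 `&` Z2 = set0 ->
    G `&` Z1 = set0 \/ G `&` Z2 = set0.

(* The coordinate ring of GL_m is the localization of the polynomial ring in  *)
(* the matrix entries at the determinant, and restriction to the closed       *)
(* subset G is surjective on regular functions.                               *)
Definition regular_on (F : fieldType) (m : nat) (G : set 'M[F]_m)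
    (u : 'M[F]_m -> F) : Prop :=
  exists (p : {mpoly F[m * m]}) (k : nat),
    forall A, G A -> u A = p.@[mxvec A ord0] / \det A ^+ k.

Definition rational_representation (F : fieldType) (m n : nat)
    (G : set 'M[F]_m) (rho : 'M[F]_m -> 'M[F]_n) : Prop :=
  [/\ forall A, G A -> rho A \in unitmx,
      forall A B, G A -> G B -> rho (A *m B) = rho A *m rho B
    & forall i j, regular_on G (fun A => rho A i j)].

Definition additive_function (F : fieldType) (m : nat) (G : set 'M[F]_m)
    (Phi : 'M[F]_m -> F) : Prop :=
  regular_on G Phi /\
  forall A B, G A -> G B -> Phi (A *m B) = Phi A + Phi B.

Definition derived_group (F : fieldType) (m : nat) (G : set 'M[F]_m) :
    set 'M[F]_m :=
  smallest (@mx_group F m)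
    [set C | exists A B,
       [/\ G A, G B & C = invmx A *m invmx B *m A *m B]].

Definition mx_setmul (F : fieldType) (m : nat) (H K : set 'M[F]_m) :
    set 'M[F]_m :=
  [set C | exists A B, [/\ H A, K B & C = A *m B]].

Definition peval (F : fieldType) (n : nat) (p : {mpoly F[n]}) (v : 'cV[F]_n) :
    F :=
  p.@[fun i => v i ord0].

Definition zero_set (F : fieldType) (n : nat) (p : {mpoly F[n]}) :
    set 'cV[F]_n :=
  [set v | peval p v = 0].

Definition zariski_closed (F : fieldType) (n : nat) (Z : set 'cV[F]_n) :
    Prop :=
  exists I : set {mpoly F[n]}, Z = [set v | forall p, I p -> peval p v = 0].

Definition zariski_open (F : fieldType) (n : nat) (U : set 'cV[F]_n) : Prop :=
  zariski_closed (~` U).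

Definition zariski_irreducible (F : fieldType) (n : nat) (W : set 'cV[F]_n) :
    Prop :=
  W !=set0 /\
  forall Z1 Z2, zariski_closed Z1 -> zariski_closed Z2 ->
    W `<=` Z1 `|` Z2 -> W `<=` Z1 \/ W `<=` Z2.

Definition irreducible_component (F : fieldType) (n : nat)
    (X W : set 'cV[F]_n) : Prop :=
  [/\ W `<=` X, zariski_irreducible W
    & forall W', W' `<=` X -> zariski_irreducible W' -> W `<=` W' -> W' = W].

Definition hypersurface (F : fieldType) (n : nat) (W : set 'cV[F]_n) : Prop :=
  exists p : {mpoly F[n]}, (forall c : F, p <> c%:MP) /\ W = zero_set p.

Definition irreducible_mpoly (F : fieldType) (n : nat) (p : {mpoly F[n]}) :
    Prop :=
  [/\ p != 0, p \isn't a GRing.unit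
    & forall a b, p = a * b -> a \is a GRing.unit \/ b \is a GRing.unit].

Definition lowest_terms (F : fieldType) (n : nat) (p q : {mpoly F[n]}) : Prop :=
  q != 0 /\
  forall d a b : {mpoly F[n]}, p = d * a -> q = d * b -> d \is a GRing.unit.

(* The rational function h is regular at v, with value c there. *)
Definition rational_value (F : fieldType) (n : nat)
    (h : {fraction {mpoly F[n]}}) (v : 'cV[F]_n) (c : F) : Prop :=
  exists p q : {mpoly F[n]},
    [/\ h = tofrac p / tofrac q, peval q v != 0 & c = peval p v / peval q v].

Definition orbit_of (F : fieldType) (m n : nat) (G : set 'M[F]_m)
    (rho : 'M[F]_m -> 'M[F]_n) (v : 'cV[F]_n) : set 'cV[F]_n :=
  [set rho A *m v | A in G].

Definition isotropy (F : fieldType) (m n : nat) (G : set 'M[F]_m)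
    (rho : 'M[F]_m -> 'M[F]_n) (v : 'cV[F]_n) : set 'M[F]_m :=
  [set A | G A /\ rho A *m v = v].

Definition open_orbit (F : fieldType) (m n : nat) (G : set 'M[F]_m)
    (rho : 'M[F]_m -> 'M[F]_n) (Omega : set 'cV[F]_n) : Prop :=
  zariski_open Omega /\ exists v, Omega = orbit_of G rho v.

Definition prehomogeneous (F : fieldType) (m n : nat) (G : set 'M[F]_m)
    (rho : 'M[F]_m -> 'M[F]_n) : Prop :=
  [/\ linear_algebraic_group G, zariski_connected G,
      rational_representation G rho & exists Omega, open_orbit G rho Omega].

Definition basic_relative_invariants (F : fieldType) (n r : nat)
    (Omega : set 'cV[F]_n) (f : r.-tuple {mpoly F[n]}) : Prop :=
  [/\ forall i, irreducible_mpoly (tnth f i),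
      forall i, irreducible_component (~` Omega) (zero_set (tnth f i)),
      forall i j, zero_set (tnth f i) = zero_set (tnth f j) -> i = j
    & forall W, irreducible_component (~` Omega) W -> hypersurface W ->
        exists i, W = zero_set (tnth f i)].

Definition additive_relative_invariant (F : fieldType) (m n : nat)
    (G : set 'M[F]_m) (rho : 'M[F]_m -> 'M[F]_n) (Omega : set 'cV[F]_n)
    (h : {fraction {mpoly F[n]}}) (Phi : 'M[F]_m -> F) : Prop :=
  additive_function G Phi /\
  forall v A, Omega v -> G A ->
    exists a b, [/\ rational_value h (rho A *m v) a, rational_value h v b
                  & a - b = Phi A].

(* The space A_1(G). *)
Definition corresponding_additive_functions (F : fieldType) (m n : nat)
    (G : set 'M[F]_m) (rho : 'M[F]_m -> 'M[F]_n) (Omega : set 'cV[F]_n) :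
    set ('M[F]_m -> F) :=
  [set Phi | exists h, additive_relative_invariant G rho Omega h Phi].

(* Basis of a vector space S of functions on G, where functions on G are      *)
(* identified when they agree on G.                                           *)
Definition function_basis (F : fieldType) (m s : nat) (G : set 'M[F]_m)
    (S : set ('M[F]_m -> F)) (Phi : 'I_s -> 'M[F]_m -> F) : Prop :=
  [/\ forall i, S (Phi i),
      forall c : 'I_s -> F,
        (forall A, G A -> \sum_i c i * Phi i A = 0) -> forall i, c i = 0
    & forall Psi, S Psi -> exists c : 'I_s -> F,
        forall A, G A -> Psi A = \sum_i c i * Phi i A].

Definition invariant_under (F : fieldType) (m n : nat)
    (rho : 'M[F]_m -> 'M[F]_n) (p : {mpoly F[n]}) (H : set 'M[F]_m) : Prop :=
  forall A, H A -> forall v, peval p (rho A *m v) = peval p v.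

Definition algebraically_independent (F : fieldType) (n k : nat)
    (t : k.-tuple {mpoly F[n]}) : Prop :=
  forall P : {mpoly F[k]}, P \mPo t = 0 -> P = 0.

(* Main.v *)
(* An element A of G maps each hypersurface component V(f_i) of the
   complement of Omega to such a component; as G is connected, it fixes V(f_i), and
   the Nullstellensatz gives f_i o A = chi_i(A) f_i. If h/g is an additive relative invariant in
   lowest terms, then (h o A) g = (h + Phi(A) g) (g o A), because both sides agree
   on the dense set Omega; unique factorization makes g divide g o A, so g o A = psi(A) g
   and h o A = psi(A) (h + Phi(A) g). Invariance under a commutator or an isotropy
   group follows from the triviality of chi_i, psi and Phi there.

   For the algebraic independence, evaluate a relation P(f, h) = 0 at A v_0. The
   monomial f^a h^b becomes a character chi^a psi^b of G times a monomial of exponent b in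
   the functions h_j(v_0) + g_j(v_0) Phi_j(A). Distinct characters are linearly
   independent over polynomial functions on G, linearly independent additive functions
   are algebraically independent in characteristic 0, and chi^a determines a, since
   monomials proportional on Omega vanish to the same order along each V(f_i). *)

Require Import Defs.
From mathcomp Require Import boolp ring.

Set Implicit Arguments.
Unset Strict Implicit.
Unset Printing Implicit Defensive.

Import GRing.Theory Num.Theory.

Local Open Scope ring_scope.
Local Open Scope classical_set_scope.

(** * Unique factorization in polynomial rings *)

Definition divides (D : idomainType) (a b : D) : Prop := exists c, b = c * a.

(** The clauses of [irreducible_mpoly] over an arbitrary domain, so that an induction on the number
    of variables can pass through [{poly D}]. *)
Definition irreducible_elt (D : idomainType) (p : D) : Prop :=
  [/\ p != 0, p \isn't a GRing.unit
    & forall a b, p = a * b -> a \is a GRing.unit \/ b \is a GRing.unit].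

(** Together with [atomic], this expresses unique factorization in [D]. *)
Definition irreducibles_prime (D : idomainType) : Prop :=
  forall p : D, irreducible_elt p ->
  forall a b, divides p (a * b) -> divides p a \/ divides p b.

(* Existence of factorizations, packaged as an induction principle. *)
Definition atomic (D : idomainType) : Prop :=
  forall P : D -> Prop,
    (forall u, u \is a GRing.unit -> P u) ->
    (forall p x, irreducible_elt p -> x != 0 -> P x -> P (p * x)) ->
    forall x, x != 0 -> P x.

(** Induction on a factorization of [g]. An irreducible factor of [g] is prime, so it divides [h] or
    [q]; the first would make it a common divisor, hence a unit. It is therefore cancelled from
    [q]. *)
Lemma coprime_divides (D : idomainType) (g h q : D) :
    irreducibles_prime D -> atomic D -> g != 0 ->
    (forall d a b, h = d * a -> g = d * b -> d \is a GRing.unit) ->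
  divides g (h * q) -> divides g q.
Proof.
move=> primeD atomicD g0; move: g g0 h q.
apply: atomicD => [u uu h q _ _|p x pirr x0 IH h q cop [w ew]].
  by exists (q / u); rewrite mulrVK.
have [ph|[q' eq]] : divides p h \/ divides p q.
  by apply: primeD => //; exists (w * x); rewrite ew; ring.
  case: ph => c ec; case: (pirr) => _ /negP[].
  by apply: (cop p c x) => //; rewrite ec mulrC.
have p0 : p != 0 by case: pirr.
have [||c ec] := IH h q'.
- by move=> d a b eh ex; apply: (cop d a (p * b)) => //; rewrite ex mulrCA.
- by exists w; apply: (mulfI p0); transitivity (h * q); [rewrite eq|rewrite ew]; ring.
- by exists c; rewrite eq ec; ring.
Qed.

(** * Gauss's lemma: unique factorization passes from [D] to [{poly D}] *)

Section Gauss.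
Variable D : idomainType.
Hypotheses (primeD : irreducibles_prime D) (atomicD : atomic D).
Implicit Types (p a b : {poly D}) (c d : D).

Lemma polyC_unit c : (c%:P \is a GRing.unit) = (c \is a GRing.unit).
Proof.
rewrite poly_unitE coefC eqxx; case: (eqVneq c 0) => [->|c0].
  by rewrite polyC0 size_poly0 unitr0.
by rewrite size_polyC c0.
Qed.

Lemma polyC_irreducible c : irreducible_elt c%:P -> irreducible_elt c.
Proof.
rewrite /irreducible_elt polyC_eq0 polyC_unit => -[c0 cNu cf]; split=> // a b ec.
by rewrite -(polyC_unit a) -(polyC_unit b); apply: cf; rewrite -polyCM -ec.
Qed.

Lemma divides_polyC c p : (forall i, divides c p`_i) -> divides c%:P p.
Proof.
move=> /choice[w ew]; exists (\poly_(i < size p) w i).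
apply/polyP => i; rewrite coefMC coef_poly; case: ltnP => [_|le_i]; first exact: ew.
by rewrite mul0r nth_default.
Qed.

Lemma unit_size p : p \is a GRing.unit -> size p = 1%N.
Proof. by rewrite poly_unitE => /andP[/eqP]. Qed.

(** If [c] divides [a * b], it divides the product of the leading coefficients, hence one of them.
    Removing that leading term preserves the divisibility and lowers the total size. *)
Lemma prime_polyC c a b : irreducible_elt c ->
  divides c%:P (a * b) -> divides c%:P a \/ divides c%:P b.
Proof.
move=> cirr; have [k] := ubnP (size a + size b).
elim: k a b => // k IH a b; rewrite ltnS => le_k [w ew].
have [->|a0] := eqVneq a 0; first by left; exists 0; rewrite mul0r.
have [->|b0] := eqVneq b 0; first by right; exists 0; rewrite mul0r.
(* Stated for an ordered pair, so that it serves both factors by symmetry. *)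
have step (x y : {poly D}) : x != 0 -> y != 0 -> (size x + size y <= k)%N ->
    divides c%:P (x * y) -> divides c (lead_coef x) ->
    divides c%:P x \/ divides c%:P y.
  move=> x0 y0 le_xy [z ez] [t et].
  pose x' := x - lead_coef x *: 'X^((size x).-1).
  have lt_x' : (size x' < size x)%N.
    rewrite [X in (_ < X)%N](polySpred x0) ltnS.
    apply/leq_sizeP => j le_j; rewrite coefB coefZ coefXn.
    have [->|nj] := eqVneq j (size x).-1; first by rewrite mulr1 subrr.
    rewrite mulr0 subr0 nth_default //.
    by rewrite (polySpred x0) ltn_neqAle eq_sym nj.
  have ex : x = x' + (t *: 'X^((size x).-1)) * c%:P.
    by rewrite mulrC mul_polyC scalerA mulrC -et subrK.
  have [||[z1 ez1]|] := IH x' y; last by right.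
  - by apply: leq_trans le_xy; rewrite ltn_add2r.
  - exists (z - t *: 'X^((size x).-1) * y).
    by rewrite /x' mulrBl ez et -mul_polyC -mul_polyC polyCM; ring.
  - by left; rewrite ex ez1 -mulrDl; eexists.
have [da|db] : divides c (lead_coef a) \/ divides c (lead_coef b).
  apply: primeD => //; exists w`_(size (a * b)).-1.
  by rewrite -lead_coefM lead_coefE ew coefMC.
- by apply: step => //; exists w.
- have [||cb|ca] := step b a b0 a0 _ _ db; [by rewrite addnC| |by right|by left].
  by exists w; rewrite mulrC.
Qed.

Section Irreducible.
Variable p : {poly D}.
Hypotheses (pirr : irreducible_elt p) (p_gt1 : (1 < size p)%N).

(** The irreducible factors of [c] are stripped one at a time. Such a factor cannot divide [p],
    which is irreducible of positive degree, so it divides the cofactor and cancels. *)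
Lemma irreducible_divides_scale c a : c != 0 ->
  divides p (c *: a) -> divides p a.
Proof.
move=> c0; move: c c0 a; apply: atomicD => [u uu a [w ew]|q x qirr x0 IH a [w ew]].
  by exists (u^-1 *: w); rewrite -scalerAl -ew scalerA mulVr // scale1r.
have q0 : q != 0 by case: qirr.
have [|[w' ew']|[s es]] := @prime_polyC q w p qirr.
- by exists (x *: a); rewrite -ew -!mul_polyC polyCM; ring.
- apply: IH; exists w'; apply: (@mulfI _ q%:P); rewrite ?polyC_eq0 // mul_polyC.
  by rewrite scalerA ew ew'; ring.
- case: (pirr) => _ _ /(_ _ _ es)[/unit_size s1|].
    by move: p_gt1; rewrite es mulrC mul_polyC size_scale // s1.
  by rewrite polyC_unit; case: qirr => _ /negbTE ->.
Qed.

(** This is irreducibility of [p] over the fraction field, with denominators cleared: each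
    irreducible factor of [c] divides [a] or [b] and is cancelled there. *)
Lemma irreducible_scale_factor c a b : c != 0 -> c *: p = a * b ->
  (size a <= 1)%N \/ (size b <= 1)%N.
Proof.
move=> c0; move: c c0 a b; apply: atomicD => [u uu a b eu|q x qirr x0 IH a b eab].
  have := pirr => -[_ _ /(_ (u^-1 *: a) b)].
  rewrite -scalerAl -eu scalerA mulVr // scale1r => /(_ erefl)[] /unit_size.
    rewrite size_scale => [->|]; first by left.
    by apply: contraTneq uu => u0; rewrite -unitrV u0 unitr0.
  by move=> ->; right.
have q0 : q != 0 by case: qirr.
have [|[a' ea]|[b' eb]] := @prime_polyC q a b qirr.
- by exists (x *: p); rewrite -eab -!mul_polyC polyCM; ring.
- have [||] := IH a' b; [|by rewrite ea mulrC mul_polyC size_scale //; left|by right].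
  apply: (@mulfI _ q%:P); rewrite ?polyC_eq0 // mul_polyC.
  by rewrite scalerA eab ea; ring.
- have [||] := IH a b'; [|by left|by rewrite eb mulrC mul_polyC size_scale //; right].
  apply: (@mulfI _ q%:P); rewrite ?polyC_eq0 // mul_polyC.
  by rewrite scalerA eab eb; ring.
Qed.

(* The pseudo-gcd of [p] and [a] is computed over the fraction field, where   *)
(* [p] remains irreducible.                                                   *)
Lemma irreducible_divides_or_Bezout a :
  divides p a \/ exists u v c, c != 0 /\ u * p + v * a = c%:P.
Proof.
have /Pdiv.Idomain.dvdpP[[c w] /= c0 ep] := Pdiv.Idomain.dvdp_gcdl p a.
have /Pdiv.Idomain.dvdpP[[c' w'] /= c'0 ea] := Pdiv.Idomain.dvdp_gcdr p a.
have p0 : p != 0 by case: pirr.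
have g0 : Pdiv.Idomain.gcdp p a != 0.
  apply/eqP => g0; move: ep; rewrite g0 mulr0 => /eqP.
  by rewrite scale_poly_eq0 (negbTE c0) (negbTE p0).
have [w1|g1] := irreducible_scale_factor c0 ep.
  (* A constant cofactor makes the gcd proportional to [p], so [p] divides a nonzero scalar multiple
     of [a]. *)
  left; have [k ek] : exists k, w = k%:P by exists w`_0; apply: size1_polyC.
  apply: (@irreducible_divides_scale (k * c')).
    rewrite mulf_neq0 //; apply: contra_neq c0 => k0; move/eqP: ep.
    by rewrite ek k0 mul0r scale_poly_eq0 (negbTE p0) orbF => /eqP.
  exists (c *: w'); rewrite -scalerA ea -[k *: _]mul_polyC -ek mulrCA -ep -!mul_polyC.
  by ring.
right; have [[u v] /Pdiv.Idomain.eqpP[[c1 c2] /= /andP[c10 c20] e]] :=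
  Pdiv.Idomain.Bezoutp p a.
have [k ek] : exists k, Pdiv.Idomain.gcdp p a = k%:P.
  by eexists; apply: size1_polyC.
exists (c1 *: u), (c1 *: v), (c2 * k); split.
  by rewrite mulf_neq0 //; move: g0; rewrite ek polyC_eq0.
by rewrite -!scalerAl -scalerDr e ek -mul_polyC polyCM.
Qed.

End Irreducible.

(** In positive degree, if [p] does not divide [a], multiplying [u * p + v * a = c] by [b] shows
    that [p] divides [c *: b], and the scalar can be removed. *)
Lemma poly_irreducibles_prime : irreducibles_prime {poly D}.
Proof.
move=> p pirr a b dab; have [p1|p_gt1] := leqP (size p) 1.
  have ep := size1_polyC p1; rewrite ep; apply: prime_polyC; last by rewrite -ep.
  by apply: polyC_irreducible; rewrite -ep.
have [|[u [v [c [c0 e]]]]] := irreducible_divides_or_Bezout pirr p_gt1 a.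
  by left.
right; apply: (irreducible_divides_scale pirr p_gt1 c0).
case: dab => w ew; exists (u * b + v * w).
by rewrite -mul_polyC -e mulrDl -[v * a * b]mulrA ew; ring.
Qed.

End Gauss.

(** * Units and irreducible factors of multivariate polynomials *)

Lemma mpoly_unit_msize (F : fieldType) n (p : {mpoly F[n]}) :
  (p \is a GRing.unit) = (msize p == 1%N).
Proof.
apply/idP/msize_poly1P => [|[c c0 ->]].
  rewrite unfold_in => /andP[/eqP ep]; rewrite unitfE => p0.
  by exists p@_0.
apply/andP; rewrite mcoeffC eqxx mulr1; split => //.
by rewrite unitfE.
Qed.

Lemma mpoly_unit_const (F : fieldType) n (p : {mpoly F[n]}) :
  p \is a GRing.unit -> exists c, p = c%:MP.
Proof. by rewrite mpoly_unit_msize => /msize_poly1P[c _ ->]; exists c. Qed.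

Lemma ltn_msizeM (F : fieldType) n (p q : {mpoly F[n]}) :
  p != 0 -> q != 0 -> p \isn't a GRing.unit -> (msize q < msize (p * q))%N.
Proof.
move=> p0 q0; rewrite mpoly_unit_msize msizeM //.
rewrite (mpolySpred _ p0) (mpolySpred _ q0).
by case: (msize p).-1 => // k _; rewrite !addSn /= ltnS leq_addl.
Qed.

Lemma mpoly_irreducible_divisor (F : fieldType) n (x : {mpoly F[n]}) :
    x != 0 -> x \isn't a GRing.unit ->
  exists p y, irreducible_elt p /\ x = p * y.
Proof.
have [k] := ubnP (msize x); elim: k x => // k IH x; rewrite ltnS => le_k x0 xNu.
have [|xred] := EM (irreducible_elt x).
  by move=> xirr; exists x, 1; rewrite mulr1.
have [a [b [ex aNu bNu]]] : exists a b,
    [/\ x = a * b, a \isn't a GRing.unit & b \isn't a GRing.unit].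
  apply: contrapT => noab; apply: xred; split=> // a b ex.
  apply: contrapT => nab; apply: noab; exists a, b.
  by split=> //; apply/negP => u; apply: nab; [left|right].
have [a0 b0] : a != 0 /\ b != 0.
  by apply/andP; rewrite -negb_or -mulf_eq0 -ex.
have [|p [y [pirr ea]]] := IH a _ a0 aNu.
  by apply: leq_trans le_k; rewrite ex mulrC ltn_msizeM.
by exists p, (y * b); rewrite ex ea mulrA.
Qed.

Lemma mpoly_atomic (F : fieldType) n : atomic {mpoly F[n]}.
Proof.
move=> P Pu PM x; have [k] := ubnP (msize x); elim: k x => // k IH x.
rewrite ltnS => le_k x0; have [/Pu//|xNu] := boolP (x \is a GRing.unit).
have [p [y [pirr ex]]] := mpoly_irreducible_divisor x0 xNu.
have [p0 pNu _] := pirr.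
have y0 : y != 0 by apply: contra_neq x0 => y0; rewrite ex y0 mulr0.
rewrite ex; apply: PM => //; apply: IH => //.
by apply: leq_trans le_k; rewrite ex ltn_msizeM.
Qed.

(* Unfolding [muni] makes failing unification problems explode. *)
Local Opaque muni.

(** * Polynomials in [n.+1] variables as univariate polynomials in the last one *)

Section Univariate.
Variables (F : fieldType) (n : nat).

Definition of_muni : {poly {mpoly F[n]}} -> {mpoly F[n.+1]} :=
  fun q => (map_poly (@mwiden n F) q).['X_ord_max].

Lemma of_muniD : {morph of_muni : p q / p + q}.
Proof. by move=> p q; rewrite /of_muni rmorphD hornerD. Qed.

Lemma muniX (m : 'X_{1..n.+1}) :
  muni 'X_[F, m] = 'X_[[multinom m (widen_ord (leqnSn n) i) | i < n]] *: 'X^(m ord_max).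
Proof. by rewrite muniE msuppX big_seq1 mcoeffX eqxx scale1r. Qed.

Lemma muniK : cancel (@muni n F) of_muni.
Proof.
elim/mpolyind => [|c m p _ _ IH].
  by rewrite /of_muni !rmorph0 horner0.
rewrite muniD of_muniD [X in _ + X]IH; congr (_ + _).
rewrite muniZ muniX /of_muni scalerA map_polyZ hornerZ.
rewrite map_polyXn hornerXn rmorphM /= mwidenC mwidenX -mulrA -mul_mpolyC.
congr (_ * _); rewrite mpolyXn -mpolyXD; congr 'X_[_]; apply/mnmP => i.
rewrite mnmDE mulmnE mnm1E; have [<-|] := eqVneq ord_max i.
  by rewrite mnmwiden_ordmax mul1n.
move=> ni; have lt_i : (i < n)%N.
  by rewrite ltn_neqAle -ltnS ltn_ord andbT; apply: contra_neq ni => e; apply: val_inj.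
have -> : i = widen_ord (leqnSn n) (Ordinal lt_i) by apply: val_inj.
by rewrite mnmwiden_widen mnmE mul0n addn0.
Qed.

Lemma muni_widen (p : {mpoly F[n]}) : muni (mwiden p) = p%:P.
Proof.
elim/mpolyind: p => [|c m p _ _ IH]; first by rewrite !rmorph0.
rewrite !rmorphD /= IH mwidenZ muniZ mwidenX muniX mnmwiden_ordmax expr0.
rewrite -mul_polyC -!mul_mpolyC; congr (_ + _).
rewrite -[_ *: 1]mul_polyC mulr1 -polyCM.
by congr (_ * 'X_[_])%:P; apply/mnmP => i; rewrite mnmE mnmwiden_widen.
Qed.

Lemma of_muniK : cancel of_muni (@muni n F).
Proof.
elim/poly_ind => [|q c IH]; first by rewrite /of_muni !rmorph0 horner0 rmorph0.
rewrite /of_muni rmorphD rmorphM /= map_polyX map_polyC hornerMXaddC rmorphD rmorphM.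
rewrite /= -/(of_muni q) IH muni_widen muniX mnm1E eqxx.
congr (_ * _ + _); rewrite (_ : [multinom _ | _ < _] = 0%MM) ?mpolyX0 ?scale1r //.
by apply/mnmP => i; rewrite mnmE mnm1E mnm0E eqE /= gtn_eqF.
Qed.

Lemma muni_unit (p : {mpoly F[n.+1]}) :
  (muni p \is a GRing.unit) = (p \is a GRing.unit).
Proof.
apply/idP/idP => [/unitrP[q [qp pq]]|/rmorph_unit->//].
apply/unitrP; exists (of_muni q).
by split; apply: (can_inj muniK); rewrite muniM of_muniK rmorph1.
Qed.

Lemma of_muni_unit (q : {poly {mpoly F[n]}}) :
  (of_muni q \is a GRing.unit) = (q \is a GRing.unit).
Proof. by rewrite -muni_unit of_muniK. Qed.

Lemma muni_irreducible (p : {mpoly F[n.+1]}) :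
  irreducible_elt p -> irreducible_elt (muni p).
Proof.
move=> [p0 pNu pf]; split.
- by apply: contra_neq p0 => e; rewrite -[p]muniK e /of_muni rmorph0 horner0.
- by rewrite muni_unit.
- move=> a b eab.
  have [|ua|ub] := pf (of_muni a) (of_muni b).
  + by apply: (can_inj muniK); rewrite muniM (of_muniK a) (of_muniK b).
  + by left; rewrite -of_muni_unit.
  + by right; rewrite -of_muni_unit.
Qed.

Lemma muni_divides (p q : {mpoly F[n.+1]}) :
  divides (muni p) (muni q) <-> divides p q.
Proof.
split=> -[c ec]; last by exists (muni c); rewrite -muniM -ec.
by exists (of_muni c); apply: (can_inj muniK); rewrite muniM of_muniK.
Qed.

Lemma muni_horner (p : {mpoly F[n.+1]}) (x : 'I_n.+1 -> F) :
  p.@[x] =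
  (map_poly (meval (fun i => x (widen_ord (leqnSn n) i))) (muni p)).[x ord_max].
Proof.
elim/mpolyind: p => [|c m p _ _ IH]; first by rewrite !rmorph0 horner0.
rewrite mevalD muniD rmorphD /= hornerD -[X in _ = _ + X]IH; congr (_ + _).
rewrite muniZ muniX scalerA map_polyZ hornerZ map_polyXn hornerXn rmorphM /=.
rewrite mevalC !mevalZ !mevalX -mulrA big_ord_recr; congr (_ * (_ * _)).
by apply: eq_bigr => i _; rewrite mnmE.
Qed.

End Univariate.

Lemma mpoly0_const (F : fieldType) (p : {mpoly F[0]}) : p = (p@_0)%:MP.
Proof.
apply/mpolyP => m; have -> : m = 0%MM by apply/mnmP => -[].
by rewrite mcoeffC eqxx mulr1.
Qed.

Lemma mpoly0_not_irreducible (F : fieldType) (p : {mpoly F[0]}) :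
  ~ irreducible_elt p.
Proof.
move=> [p0 /negP pNu _]; case: pNu; rewrite mpoly_unit_msize; apply/msize_poly1P.
exists p@_0; last exact: mpoly0_const.
by apply: contra_neq p0 => e; rewrite (mpoly0_const p) e mpolyC0.
Qed.

Lemma mpoly_irreducibles_prime (F : fieldType) n :
  irreducibles_prime {mpoly F[n]}.
Proof.
elim: n => [p /mpoly0_not_irreducible//|n IH p pirr a b].
move=> /(muni_divides p (a * b)).2; rewrite muniM => d.
have [/(muni_divides p a).1|/(muni_divides p b).1] := poly_irreducibles_prime
  IH (@mpoly_atomic F n) (muni_irreducible pirr) d; by [left|right].
Qed.

(** * Nullstellensatz for an irreducible hypersurface *)

(** In characteristic zero the natural numbers are infinitely many distinct roots. *)
Lemma poly_natr_roots (F : numDomainType) (p : {poly F}) :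
  (forall k : nat, p.[k%:R] = 0) -> p = 0.
Proof.
move=> p_root; apply/eqP; apply: contraT => p0.
have := @max_poly_roots _ p [seq k%:R | k <- iota 0 (size p)] p0.
rewrite size_map size_iota ltnn; apply.
  by apply/allP => _ /mapP[k _ ->]; apply/rootP.
by rewrite map_inj_uniq ?iota_uniq // => i j /eqP; rewrite eqr_nat => /eqP.
Qed.

Definition extend_point (F : Type) n (x : 'I_n -> F) (t : F) : 'I_n.+1 -> F :=
  fun i => oapp x t (unlift ord_max i).

Lemma mevalS (F : fieldType) n (p : {mpoly F[n.+1]}) (x : 'I_n -> F) t :
  p.@[extend_point x t] = (map_poly (meval x) (muni p)).[t].
Proof.
rewrite muni_horner /extend_point unlift_none; congr (_.[t]).
apply: eq_map_poly => q; apply: meval_eq => i.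
rewrite (_ : widen_ord _ i = lift ord_max i) ?liftK //.
by apply: val_inj; rewrite /= /bump leqNgt ltn_ord.
Qed.

Lemma mpoly_fun_eq0 (F : numFieldType) n (p : {mpoly F[n]}) :
  (forall x : 'I_n -> F, p.@[x] = 0) -> p = 0.
Proof.
elim: n p => [p /(_ (fun=> 0))|n IH p p_eq0].
  by rewrite (mpoly0_const p) mevalC => ->; rewrite mpolyC0.
apply: (can_inj (@muniK _ _)); rewrite muni0; apply/polyP => i; rewrite coef0.
apply: IH => x; rewrite -(coef_map (meval x)).
rewrite (poly_natr_roots (p := map_poly (meval x) (muni p))) ?coef0 // => k.
by rewrite -mevalS.
Qed.

Lemma mpoly_fun_inj (F : numFieldType) n (p q : {mpoly F[n]}) :
  (forall x : 'I_n -> F, p.@[x] = q.@[x]) -> p = q.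
Proof.
move=> e; apply/eqP; rewrite -subr_eq0; apply/eqP/mpoly_fun_eq0 => x.
by rewrite mevalB e subrr.
Qed.

Lemma irreducible_nullstellensatz (F : numClosedFieldType) n
    (f q : {mpoly F[n]}) :
  irreducible_elt f -> (forall x : 'I_n -> F, f.@[x] = 0 -> q.@[x] = 0) ->
  divides f q.
Proof.
elim: n f q => [f q /mpoly0_not_irreducible//|n IH f q firr fq].
apply/muni_divides; have Mirr := muni_irreducible firr.
have [f1|f_gt1] := leqP (size (muni f)) 1.
  have ef := size1_polyC f1; rewrite ef in Mirr *.
  apply: divides_polyC => i; apply: IH; first exact: polyC_irreducible.
  move=> x fx; rewrite -(coef_map (meval x)).
  rewrite (poly_natr_roots (p := map_poly (meval x) (muni q))) ?coef0 // => k.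
  by rewrite -mevalS; apply: fq; rewrite mevalS ef map_polyC hornerC.
have [//|[u [v [c [c0 e]]]]] := irreducible_divides_or_Bezout
  (@mpoly_irreducibles_prime F n) (@mpoly_atomic F n) Mirr f_gt1 (muni q).
have l0 : lead_coef (muni f) != 0 by rewrite lead_coef_eq0; case: Mirr.
(* The nonzero polynomial [c * lead_coef (muni f)] vanishes everywhere: where the leading
   coefficient is nonzero, specialization keeps the degree of [f], so [f] has a root [t] above [x];
   [q] vanishes there too, and hence so does [c]. *)
case/eqP: (mulf_neq0 c0 l0); apply: mpoly_fun_eq0 => x; rewrite mevalM.
have [->|lx] := eqVneq (lead_coef (muni f)).@[x] 0; first by rewrite mulr0.
have /closed_rootP[t /rootP ft] : size (map_poly (meval x) (muni f)) != 1%N.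
  rewrite size_poly_eq ?neq_ltn ?f_gt1 ?orbT //.
have := fq (extend_point x t); rewrite !mevalS => /(_ ft) qt.
move: (muni f) (muni q) (lead_coef _) e ft qt {l0 lx} => f' q' l e ft qt.
have /(congr1 (fun r => (map_poly (meval x) r).[t])) := e.
rewrite rmorphD !rmorphM /= hornerD !hornerM ft qt !mulr0 addr0 map_polyC hornerC.
by move=> <-; rewrite mul0r.
Qed.

(** * Semi-invariants of a connected group *)

Section LinearSubstitution.
Variables (F : numFieldType) (n : nat).
Implicit Types (p q : {mpoly F[n]}) (M : 'M[F]_n) (v : 'cV[F]_n).

Definition mx_comp p M : {mpoly F[n]} :=
  p \mPo [tuple \sum_j M i j *: 'X_j | i < n].

Lemma peval_mx_comp p M v : peval (mx_comp p M) v = peval p (M *m v).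
Proof.
rewrite /peval /mx_comp comp_mpoly_meval; apply: meval_eq => i.
rewrite tnth_mktuple raddf_sum mxE; apply: eq_bigr => j _.
by rewrite /= mevalZ mevalXU.
Qed.

Lemma peval_inj p q : (forall v, peval p v = peval q v) -> p = q.
Proof.
move=> e; apply: mpoly_fun_inj => x.
have := e (\col_i x i); rewrite /peval.
by congr (_ = _); apply: meval_eq => i; rewrite mxE.
Qed.

Lemma pevalM p q v : peval (p * q) v = peval p v * peval q v.
Proof. exact: mevalM. Qed.

Lemma pevalD p q v : peval (p + q) v = peval p v + peval q v.
Proof. exact: mevalD. Qed.

Lemma pevalZ c p v : peval (c *: p) v = c * peval p v.
Proof. exact: mevalZ. Qed.

Lemma pevalC c v : peval c%:MP_[n] v = c.
Proof. exact: mevalC. Qed.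

(** With quotients [c] for [M] and [d] for its inverse, substituting one identity into the other
    gives [mx_comp d M * c = 1]. So [c] is a unit, that is, a constant. *)
Lemma semi_invariant_of_divides p M : p != 0 -> M \in unitmx ->
  divides p (mx_comp p M) -> divides p (mx_comp p (invmx M)) ->
  exists c, forall v, peval p (M *m v) = c * peval p v.
Proof.
move=> p0 Mu [c ec] [d ed].
have /(mulIf p0) e : mx_comp d M * c * p = 1 * p.
  rewrite mul1r; apply: peval_inj => v.
  rewrite !pevalM -mulrA -pevalM -ec !peval_mx_comp -pevalM -ed.
  by rewrite peval_mx_comp mulmxA mulVmx // mul1mx.
have /mpoly_unit_const[k ek] : c \is a GRing.unit.
  by apply/unitrP; exists (mx_comp d M); rewrite e mulrC e.
by exists k => v; rewrite -peval_mx_comp ec pevalM ek pevalC.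
Qed.

(** Some equation [q] of the complement is nonzero at [v0]. The product [p * q] vanishes everywhere,
    and the polynomial ring is a domain. *)
Lemma zariski_open_dense (U : set 'cV[F]_n) v0 p : zariski_open U -> U v0 ->
  (forall v, U v -> peval p v = 0) -> p = 0.
Proof.
move=> [I eI] Uv0 pU.
have [q Iq qv0] : exists2 q, I q & peval q v0 <> 0.
  apply: contrapT => nq; have : (~` U) v0; last by [].
  by rewrite eI => q Iq; apply: contrapT => qv0; apply: nq; exists q.
have /eqP : p * q = 0.
  apply: peval_inj => v; rewrite pevalM -[0 in RHS]mpolyC0 pevalC.
  have [/pU->|NUv] := EM (U v); first by rewrite mul0r.
  have : (~` U) v by []; rewrite eI => /(_ q Iq) ->.
  by rewrite mulr0.
rewrite mulf_eq0 => /orP[/eqP//|/eqP q0]; case: qv0.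
by rewrite q0 -mpolyC0 pevalC.
Qed.

Definition preim_mx M (W : set 'cV[F]_n) : set 'cV[F]_n := [set v | W (M *m v)].

Lemma zariski_closed_preim M Z : zariski_closed Z -> zariski_closed (preim_mx M Z).
Proof.
move=> [I ->]; exists [set mx_comp p M | p in I]; apply/seteqP; split => v /=.
  by move=> Zv _ [p Ip <-]; rewrite peval_mx_comp; apply: Zv.
by move=> Zv p Ip; rewrite -peval_mx_comp; apply: Zv; exists p.
Qed.

Lemma preim_mxK M W : M \in unitmx -> preim_mx M (preim_mx (invmx M) W) = W.
Proof.
by move=> Mu; apply/seteqP; split => v; rewrite /preim_mx /= mulmxA mulVmx // mul1mx.
Qed.

Lemma preim_mxVK M W : M \in unitmx -> preim_mx (invmx M) (preim_mx M W) = W.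
Proof.
by move=> Mu; apply/seteqP; split => v; rewrite /preim_mx /= mulmxA mulmxV // mul1mx.
Qed.

Lemma zariski_irreducible_preim M W : M \in unitmx ->
  zariski_irreducible W -> zariski_irreducible (preim_mx M W).
Proof.
move=> Mu [[w Ww] Wirr]; split.
  by exists (invmx M *m w); rewrite /preim_mx /= mulmxA mulmxV // mul1mx.
move=> Z1 Z2 Z1c Z2c sub.
have [] := Wirr _ _ (zariski_closed_preim (invmx M) Z1c)
                    (zariski_closed_preim (invmx M) Z2c).
- by move=> v; rewrite -[W](preim_mxVK _ Mu) => /sub.
- by move=> s; left; rewrite -[Z1](preim_mxK _ Mu) => v /s.
- by move=> s; right; rewrite -[Z2](preim_mxK _ Mu) => v /s.
Qed.

Lemma irreducible_component_preim M X W : M \in unitmx -> preim_mx M X = X ->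
  irreducible_component X W -> irreducible_component X (preim_mx M W).
Proof.
move=> Mu MX [WX Wirr Wmax]; split.
- by rewrite -[X in _ `<=` X]MX => v /WX.
- exact: zariski_irreducible_preim.
- move=> W' W'X W'irr sub; rewrite -[W'](preim_mxK _ Mu); congr preim_mx.
  apply: Wmax; last by move=> v; rewrite -[W](preim_mxVK _ Mu) => /sub.
    by rewrite -[X](preim_mxVK _ Mu) MX => v /W'X.
  by apply: zariski_irreducible_preim => //; rewrite unitmx_inv.
Qed.

End LinearSubstitution.

(** * Regular functions on a matrix group and their zero loci *)

Section RegularFunctions.
Variables (F : fieldType) (m : nat) (G : set 'M[F]_m).
Hypothesis G_unit : G `<=` [set A | A \in unitmx].
Implicit Types u w : 'M[F]_m -> F.

Definition det_mpoly : {mpoly F[m * m]} :=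
  \det (\matrix_(i < m, j < m) 'X_(mxvec_index i j) : 'M[{mpoly F[m * m]}]_m).

Lemma meval_det_mpoly (A : 'M[F]_m) : det_mpoly.@[mxvec A ord0] = \det A.
Proof.
rewrite /det_mpoly -[LHS](det_map_mx (meval (mxvec A ord0))); congr (\det _).
by apply/matrixP => i j; rewrite 2!mxE /= mevalXU mxvecE.
Qed.

Lemma group_det_neq0 A : G A -> \det A != 0.
Proof. by move/G_unit; rewrite /= unitmxE unitfE. Qed.

Lemma regular_cst c : regular_on G (fun=> c).
Proof. by exists c%:MP, 0 => A _; rewrite mevalC expr0 divr1. Qed.

Lemma regularD u w : regular_on G u -> regular_on G w ->
  regular_on G (fun A => u A + w A).
Proof.
move=> [p [k eu]] [q [l ew]].
exists (p * det_mpoly ^+ l + q * det_mpoly ^+ k), (k + l)%N => A GA.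
rewrite eu // ew // mevalD !mevalM !rmorphXn /= !meval_det_mpoly exprD.
have dk := expf_neq0 k (group_det_neq0 GA).
have dl := expf_neq0 l (group_det_neq0 GA).
by field; rewrite dk dl.
Qed.

Lemma regularM u w : regular_on G u -> regular_on G w ->
  regular_on G (fun A => u A * w A).
Proof.
move=> [p [k eu]] [q [l ew]]; exists (p * q), (k + l)%N => A GA.
by rewrite eu // ew // mevalM exprD invfM mulrACA.
Qed.

Lemma regular_meval n (p : {mpoly F[n]}) (u : 'I_n -> 'M[F]_m -> F) :
  (forall i, regular_on G (u i)) -> regular_on G (fun A => p.@[u^~ A]).
Proof.
move=> ureg; elim/mpolyind: p => [|c a p _ _ IH].
  by have [q [k e]] := regular_cst 0; exists q, k => A /e; rewrite meval0.
(* [regular_on] constrains values on [G] only, so the witnesses for one formula serve for any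
   formula agreeing with it there. *)
suff [q [k e]] : regular_on G (fun A => c * \prod_i u i A ^+ a i + p.@[u^~ A]).
  by exists q, k => A /e; rewrite mevalD mevalZ mevalX.
apply: regularD => //; apply: regularM; first exact: regular_cst.
elim: (index_enum _) => [|i s IHs].
  by have [q [k e]] := regular_cst 1; exists q, k => A /e; rewrite big_nil.
suff [q [k e]] : regular_on G (fun A => u i A ^+ a i * \prod_(j <- s) u j A ^+ a j).
  by exists q, k => A /e; rewrite big_cons.
apply: regularM => //; elim: (a i) => [|b IHb]; first exact: regular_cst.
suff [q [k e]] : regular_on G (fun A => u i A * u i A ^+ b).
  by exists q, k => A /e; rewrite exprS.
exact: regularM.
Qed.

(** The determinant is invertible on [G], so clearing denominators leaves zeros in [G] unchanged. *)
Lemma regular_zero_locus (S : set ('M[F]_m -> F)) : S `<=` regular_on G ->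
  exists2 Z, mx_zariski_closed Z & forall A, G A -> Z A <-> forall u, S u -> u A = 0.
Proof.
move=> Sreg; pose I : set {mpoly F[m * m]} :=
  [set p | exists2 u, S u & forall A, G A -> u A = 0 <-> p.@[mxvec A ord0] = 0].
exists [set A | forall p, I p -> p.@[mxvec A ord0] = 0]; first by exists I.
move=> A GA; split=> [ZA u Su|SA p [u Su /(_ A GA)[e _]]]; last exact/e/SA.
have [p [k eu]] := Sreg u Su; rewrite eu // ZA ?mul0r //; exists u => // B GB.
rewrite eu //; split=> [/eqP|->]; last by rewrite mul0r.
by rewrite mulf_eq0 invr_eq0 (negbTE (expf_neq0 _ (group_det_neq0 GB))) orbF => /eqP.
Qed.

End RegularFunctions.

(** * The action of the group on polynomials and on components *)

Section Representation.
Variables (F : numClosedFieldType) (m n : nat).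
Variables (G : set 'M[F]_m) (rho : 'M[F]_m -> 'M[F]_n).
Hypotheses (hgrp : mx_group G) (hrep : rational_representation G rho).
Implicit Types (A B : 'M[F]_m) (p : {mpoly F[n]}) (v : 'cV[F]_n).

Lemma group_unit A : G A -> A \in unitmx.
Proof. by case: hgrp => + _ _ _; apply. Qed.

Lemma group_one : G 1%:M.
Proof. by case: hgrp. Qed.

Lemma groupMx A B : G A -> G B -> G (A *m B).
Proof. by case: hgrp => _ _ + _; apply. Qed.

Lemma groupVx A : G A -> G (invmx A).
Proof. by case: hgrp => _ _ _; apply. Qed.

#[local] Hint Resolve group_unit group_one groupMx groupVx : core.

Lemma rep_unit A : G A -> rho A \in unitmx.
Proof. by case: hrep => + _ _; apply. Qed.

Lemma repM A B : G A -> G B -> rho (A *m B) = rho A *m rho B.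
Proof. by case: hrep => _ + _; apply. Qed.

Lemma rep1 : rho 1%:M = 1%:M.
Proof.
have u1 := rep_unit group_one.
by rewrite -[LHS](mulKmx u1) -repM // mulmx1 mulVmx.
Qed.

Lemma repV A : G A -> rho (invmx A) = invmx (rho A).
Proof.
move=> GA; have uA := rep_unit GA.
have e : rho A *m rho (invmx A) = 1%:M.
  by rewrite -repM ?mulmxV ?rep1; auto.
by rewrite -[LHS](mulKmx uA) e mulmx1.
Qed.

Lemma regular_peval p v : regular_on G (fun A => peval p (rho A *m v)).
Proof.
have [_ _ rreg] := hrep.
apply: (@regular_meval _ _ _ group_unit _ p (fun i A => (rho A *m v) i ord0)) => i.
suff [q [k e]] : regular_on G (fun A => \sum_j rho A i j * v j ord0).
  by exists q, k => A /e; rewrite mxE.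
elim: (index_enum _) => [|j s IH].
  by have [q [k e]] := regular_cst G 0; exists q, k => A /e; rewrite big_nil.
suff [q [k e]] : regular_on G
    (fun A => rho A i j * v j ord0 + \sum_(j <- s) rho A i j * v j ord0).
  by exists q, k => A /e; rewrite big_cons.
by apply: (regularD group_unit) => //; apply: regularM => //; apply: regular_cst.
Qed.

Definition semi_invariant p (chi : 'M[F]_m -> F) : Prop :=
  forall A, G A -> forall v, peval p (rho A *m v) = chi A * peval p v.

(** Divisibility for [A] and for its inverse makes the quotient constant; evaluation at [v0]
    identifies it. *)
Lemma semi_invariant_intro p v0 : peval p v0 != 0 ->
    (forall A, G A -> divides p (mx_comp p (rho A))) ->
  semi_invariant p (fun A => peval p (rho A *m v0) / peval p v0).
Proof.
move=> pv0 dp A GA v; have p0 : p != 0 by apply: contra_neq pv0 => ->; rewrite -mpolyC0 pevalC.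
have := dp _ (groupVx GA); rewrite repV // => dpV.
have [c ec] := semi_invariant_of_divides p0 (rep_unit GA) (dp _ GA) dpV.
by rewrite !ec mulfK.
Qed.

Lemma semi_invariantM p chi : p != 0 -> semi_invariant p chi ->
  forall A B, G A -> G B -> chi (A *m B) = chi A * chi B.
Proof.
move=> p0 pchi A B GA GB.
have [v pv] : exists v, peval p v <> 0.
  apply: contrapT => np; case/eqP: p0; apply: peval_inj => v.
  by rewrite -mpolyC0 pevalC; apply: contrapT => pv; apply: np; exists v.
apply: (mulIf (introN eqP pv)).
rewrite -pchi; last by auto.
by rewrite repM // -mulmxA !pchi // mulrA.
Qed.

Lemma semi_invariant1 p chi : p != 0 -> semi_invariant p chi -> chi 1%:M = 1.
Proof.
move=> p0 pchi.
have [v pv] : exists v, peval p v <> 0.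
  apply: contrapT => np; case/eqP: p0; apply: peval_inj => v.
  by rewrite -mpolyC0 pevalC; apply: contrapT => pv; apply: np; exists v.
by apply: (mulIf (introN eqP pv)); rewrite -pchi // rep1 mul1mx mul1r.
Qed.

(** The elements of [G] that fix [p] form a group containing all commutators, and [derived_group G]
    is the smallest such group. *)
Lemma invariant_derived p :
  (forall A B, G A -> G B -> forall v,
     peval p (rho (invmx A *m invmx B *m A *m B) *m v) = peval p v) ->
  invariant_under rho p (derived_group G) /\ derived_group G `<=` G.
Proof.
move=> pcomm.
pose S : set 'M[F]_m :=
  [set A | G A /\ forall v, peval p (rho A *m v) = peval p v].
suff sub : derived_group G `<=` S by split=> A /sub[].
apply: smallest_sub => [|_ [A [B [GA GB ->]]]]; last first.
  by split=> [|v]; [auto 6|exact: pcomm].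
split=> [A [/group_unit]//||A B [GA pA] [GB pB]|A [GA pA]].
- by split=> // v; rewrite rep1 mul1mx.
- by split=> [|v]; [auto|rewrite repM // -mulmxA pA pB].
- split=> [|v]; first by auto.
  by rewrite repV // -[v in RHS](mulKVmx (rep_unit GA)) pA.
Qed.

Lemma invariant_setmul p (H K : set 'M[F]_m) : H `<=` G -> K `<=` G ->
  invariant_under rho p H -> invariant_under rho p K ->
  invariant_under rho p (mx_setmul H K).
Proof.
move=> HG KG pH pK _ [A [B [HA KB ->]]] v.
have GA := HG _ HA; have GB := KG _ KB.
by rewrite repM // -mulmxA pH // pK.
Qed.

Lemma orbit_stable Omega A v : (exists w, Omega = orbit_of G rho w) -> G A ->
  Omega (rho A *m v) <-> Omega v.
Proof.
move=> [w ->] GA; split=> [] [B GB eB].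
  exists (invmx A *m B); first by auto.
  rewrite (repM (groupVx GA) GB) -mulmxA eB mulmxA repV // mulVmx ?mul1mx //.
  exact: rep_unit.
by exists (A *m B); [auto|rewrite repM // -mulmxA eB].
Qed.

Lemma orbit_transitive Omega v0 v : (exists w, Omega = orbit_of G rho w) ->
  Omega v0 -> Omega v -> exists2 A, G A & v = rho A *m v0.
Proof.
move=> [w ->] [A GA <-] [B GB <-].
exists (B *m invmx A); first by auto.
by rewrite (repM GB (groupVx GA)) -mulmxA [rho (invmx A) *m _]mulmxA repV // mulVmx ?mul1mx // rep_unit.
Qed.

(* [G] permutes the hypersurface components of the complement of [Omega]. The *)
(* elements mapping [V(f_i)] to itself and those mapping it into another one  *)
(* form disjoint closed sets, because [v_i] lies on [V(f_i)] only.            *)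
Lemma connected_stabilizes_component r (Omega : set 'cV[F]_n)
    (f : r.-tuple {mpoly F[n]}) (vf : 'I_r -> 'cV[F]_n) :
    zariski_connected G -> (exists w, Omega = orbit_of G rho w) ->
    basic_relative_invariants Omega f ->
    (forall i, zero_set (tnth f i) (vf i)) ->
    (forall i j, j != i -> ~ zero_set (tnth f j) (vf i)) ->
  forall A, G A -> forall i w, zero_set (tnth f i) w ->
    zero_set (tnth f i) (rho A *m w).
Proof.
move=> Gconn Gorb [firr fcomp _ fall] vf1 vf2 A0 GA0 i w0 W0.
pose W := zero_set (tnth f i).
(* The image of [W] under [rho A] is again a hypersurface component of the complement, hence some
   [V(f_j)]. *)
have perm A : G A -> exists j, forall w, W w <-> zero_set (tnth f j) (rho A *m w).
  move=> GA; have uA := rep_unit GA; have uV : invmx (rho A) \in unitmx.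
    by rewrite unitmx_inv.
  have [||j ej] := fall (preim_mx (invmx (rho A)) W).
  - apply: irreducible_component_preim; [exact: uV| |exact: fcomp].
    by apply/seteqP; split=> v; rewrite /preim_mx /= -repV // orbit_stable //; auto.
  - exists (mx_comp (tnth f i) (invmx (rho A))); split.
      move=> c ec; have [f0 fNu _] := firr i; case/negP: (fNu).
      have ef : tnth f i = c%:MP.
        apply: peval_inj => v; rewrite pevalC -[v in LHS](mulKmx uA).
        by rewrite -peval_mx_comp ec pevalC.
      rewrite ef mpoly_unit_msize; apply/msize_poly1P; exists c => //.
      by apply: contra_neq f0 => c0; rewrite ef c0 mpolyC0.
    by apply/seteqP; split=> v; rewrite /zero_set /= peval_mx_comp.
  - exists j => w; rewrite -ej /preim_mx /= mulKmx //.
pose other := \prod_(j < r | j != i) tnth f j.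
have [|Z1 Z1c eZ1] := @regular_zero_locus _ _ _ group_unit ([set u | exists2 w, W w &
    u = fun A => peval (tnth f i) (rho A *m w)]).
    by move=> _ [w _ ->]; apply: regular_peval.
have [|Z2 Z2c eZ2] := @regular_zero_locus _ _ _ group_unit ([set u | exists2 w, W w &
    u = fun A => peval other (rho A *m w)]).
    by move=> _ [w _ ->]; apply: regular_peval.
have other0 v : peval other v = 0 <-> exists2 j, j != i & zero_set (tnth f j) v.
  rewrite /peval /other rmorph_prod /=; split=> [/eqP/prodf_eq0[j nj /eqP fj]|[j nj fj]].
    by exists j.
  by apply/eqP/prodf_eq0; exists j => //; apply/eqP.
have sub : G `<=` Z1 `|` Z2.
  move=> A GA; have [j ej] := perm A GA.
  have [eji|nji] := eqVneq j i; [left|right].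
    by apply/eZ1 => // _ [w Ww ->]; rewrite -eji; apply: (ej w).1.
  by apply/eZ2 => // _ [w Ww ->]; apply/other0; exists j => //; apply: (ej w).1.
(* If [A] maps [W] onto [V(f_j)], it maps a point of [W] to [vf j]. Membership in [Z1] gives
   [i = j], and membership in [Z2] then makes another [f_k] vanish at [vf i]. *)
have disj : G `&` Z1 `&` Z2 = set0.
  apply/seteqP; split=> // A [[GA /(eZ1 _ GA) z1] /(eZ2 _ GA) z2].
  have [j ej] := perm A GA.
  pose w := invmx (rho A) *m vf j.
  have Aw : rho A *m w = vf j by rewrite /w mulKVmx // rep_unit.
  have Ww : W w by apply: (ej w).2; rewrite Aw.
  have eij : i = j.
    apply/eqP; apply: contraT => nij; case: (vf2 j i nij).
    by rewrite -Aw; apply: (z1 _ (ex_intro2 _ _ w Ww erefl)).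
  have /other0[k nki] := z2 _ (ex_intro2 _ _ w Ww erefl).
  by rewrite Aw -eij; apply: vf2.
(* The identity lies in [Z1], so by connectedness no element of [G] lies in [Z2]. *)
have [G1Z|GZ2] := Gconn Z1 Z2 Z1c Z2c sub disj.
  suff : (G `&` Z1) 1%:M by rewrite G1Z.
  by split=> //; apply/eZ1 => // _ [w Ww ->]; rewrite rep1 mul1mx.
have [/(eZ1 _ GA0) z1|Z2A] := sub _ GA0; first exact: (z1 _ (ex_intro2 _ _ w0 W0 erefl)).
by have : (G `&` Z2) A0 by []; rewrite GZ2.
Qed.

End Representation.

(** * Characters and polynomial functions on a group *)

Section GroupFunctions.
Variables (F : numFieldType) (m : nat) (G : set 'M[F]_m).
Hypotheses (G1 : G 1%:M) (GM : forall A B, G A -> G B -> G (A *m B)).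
Implicit Types (A B : 'M[F]_m) (phi psi X : 'M[F]_m -> F).

(* [phi] restricts to a polynomial function of degree less than [d] on [G]:   *)
(* any [d] successive differences annihilate it.                              *)
Fixpoint degree_lt d phi : Prop :=
  if d is d'.+1 then
    forall B, G B -> degree_lt d' (fun A => phi (A *m B) - phi A)
  else forall A, G A -> phi A = 0.

Definition polynomial_on phi : Prop := exists d, degree_lt d phi.

Lemma eq_degree_lt d phi psi : (forall A, G A -> phi A = psi A) ->
  degree_lt d phi -> degree_lt d psi.
Proof.
elim: d phi psi => [|d IH] phi psi e dphi; first by move=> A GA; rewrite -e // dphi.
move=> B GB; apply: IH (dphi B GB) => A GA.
by rewrite !e //; apply: GM.
Qed.

Lemma degree_ltD d phi psi : degree_lt d phi -> degree_lt d psi ->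
  degree_lt d (fun A => phi A + psi A).
Proof.
elim: d phi psi => [|d IH] phi psi dphi dpsi.
  by move=> A GA; rewrite dphi // dpsi // addr0.
move=> B GB; apply: eq_degree_lt (IH _ _ (dphi B GB) (dpsi B GB)) => A _.
by rewrite opprD addrACA.
Qed.

Lemma degree_ltS d phi : degree_lt d phi -> degree_lt d.+1 phi.
Proof.
elim: d phi => [|d IH] phi dphi B GB; last exact/IH/dphi.
by move=> A GA; rewrite !dphi ?subrr //; apply: GM.
Qed.

Lemma degree_lt_leq d e phi : (d <= e)%N -> degree_lt d phi -> degree_lt e phi.
Proof.
move=> /subnK <- dphi; elim: (e - d)%N => // k IH.
by rewrite addSn; apply: degree_ltS.
Qed.

Lemma degree_lt_shift d phi B : G B -> degree_lt d phi ->
  degree_lt d (fun A => phi (A *m B)).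
Proof.
move=> GB dphi; case: d dphi => [|d] dphi.
  by move=> A GA; apply: dphi; apply: GM.
apply: eq_degree_lt (degree_ltD dphi (degree_ltS (dphi B GB))) => A _.
by rewrite addrC subrK.
Qed.

(** Induction on [d + e] by the discrete Leibniz rule: the difference of a product is the difference
    of [phi] times [psi], plus the translate of [phi] times the difference of [psi]. *)
Lemma degree_ltM d e phi psi : degree_lt d phi -> degree_lt e psi ->
  degree_lt (d + e) (fun A => phi A * psi A).
Proof.
have [k] := ubnP (d + e); elim: k d e phi psi => // k IH [|d] [|e] phi psi le_k dphi dpsi.
- by move=> A GA; rewrite dphi // mul0r.
- apply: (@degree_lt_leq 0) => // A GA; by rewrite dphi // mul0r.
- apply: (@degree_lt_leq 0) => // A GA; by rewrite dpsi // mulr0.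
move=> B GB.
have lt_k : (d + e.+1 < k)%N by move: le_k; rewrite addSn ltnS.
have H1 := IH _ _ _ _ lt_k (dphi B GB) dpsi.
have H2 := IH d.+1 e _ _ _ (degree_lt_shift GB dphi) (dpsi B GB).
rewrite addSnnS in H2; have := degree_ltD H1 (H2 lt_k).
by apply: eq_degree_lt => A _ /=; ring.
Qed.

Lemma degree_ltZ d c phi : degree_lt d phi -> degree_lt d (fun A => c * phi A).
Proof.
elim: d phi => [|d IH] phi dphi; first by move=> A GA; rewrite dphi // mulr0.
by move=> B GB; apply: eq_degree_lt (IH _ (dphi B GB)) => A _; rewrite mulrBr.
Qed.

Lemma polynomial_on_cst c : polynomial_on (fun=> c).
Proof. by exists 1%N => B _ A _; rewrite subrr. Qed.

Lemma polynomial_on_additive phi :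
  (forall A B, G A -> G B -> phi (A *m B) = phi A + phi B) -> polynomial_on phi.
Proof.
(* The first difference along [B] is the constant [phi B]; the second vanishes. *)
move=> phiD; exists 2%N => B GB C GC A GA.
rewrite !phiD //; last exact: GM.
ring.
Qed.

Lemma eq_polynomial_on phi psi : (forall A, G A -> phi A = psi A) ->
  polynomial_on phi -> polynomial_on psi.
Proof. by move=> e [d /(eq_degree_lt e)]; exists d. Qed.

Lemma polynomial_onM phi psi : polynomial_on phi -> polynomial_on psi ->
  polynomial_on (fun A => phi A * psi A).
Proof. by move=> [d dphi] [e dpsi]; exists (d + e)%N; apply: degree_ltM. Qed.

Lemma polynomial_onD phi psi : polynomial_on phi -> polynomial_on psi ->
  polynomial_on (fun A => phi A + psi A).
Proof.
move=> [d dphi] [e dpsi]; exists (d + e)%N; apply: degree_ltD.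
  exact: degree_lt_leq (leq_addr _ _) dphi.
exact: degree_lt_leq (leq_addl _ _) dpsi.
Qed.

Lemma polynomial_on_shift phi B : G B -> polynomial_on phi ->
  polynomial_on (fun A => phi (A *m B)).
Proof. by move=> GB [d dphi]; exists d; apply: degree_lt_shift. Qed.

Lemma polynomial_on_meval k (Q : {mpoly F[k]}) (u : 'I_k -> 'M[F]_m -> F) :
  (forall i, polynomial_on (u i)) -> polynomial_on (fun A => Q.@[u^~ A]).
Proof.
move=> upol; elim/mpolyind: Q => [|c a p _ _ IH].
  by apply: eq_polynomial_on (polynomial_on_cst 0) => A _; rewrite meval0.
suff /eq_polynomial_on : polynomial_on (fun A => c * \prod_i u i A ^+ a i + p.@[u^~ A]).
  by apply=> A _; rewrite mevalD mevalZ mevalX.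
apply: polynomial_onD => //; apply: polynomial_onM; first exact: polynomial_on_cst.
elim: (index_enum _) => [|i s IHs].
  by apply: eq_polynomial_on (polynomial_on_cst 1) => A _; rewrite big_nil.
suff /eq_polynomial_on : polynomial_on
    (fun A => u i A ^+ a i * \prod_(j <- s) u j A ^+ a j).
  by apply=> A _; rewrite big_cons.
apply: polynomial_onM => //; elim: (a i) => [|b IHb]; first exact: polynomial_on_cst.
suff /eq_polynomial_on : polynomial_on (fun A => u i A * u i A ^+ b).
  by apply=> A _; rewrite exprS.
exact: polynomial_onM.
Qed.

(** The difference of [phi] along [B] is [(c - 1) * phi]. It satisfies the same eigenvalue equation
    in lower degree, so it vanishes by induction. *)
Lemma polynomial_on_eigen phi B c : polynomial_on phi -> G B -> c != 1 ->
  (forall A, G A -> phi (A *m B) = c * phi A) -> forall A, G A -> phi A = 0.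
Proof.
move=> [d dphi] GB c1; elim: d phi dphi => [|d IH] phi dphi e; first exact: dphi.
move=> A GA; have := IH _ (dphi B GB) _ A GA.
rewrite e // => H; apply: (mulfI (_ : c - 1 != 0)); first by rewrite subr_eq0.
rewrite mulr0 mulrBl mul1r H // => C GC.
by rewrite !e ?mulrBr //; apply: GM.
Qed.

Definition character_on X : Prop :=
  (forall A B, G A -> G B -> X (A *m B) = X A * X B) /\
  (forall A, G A -> X A != 0).

(* Dedekind's independence of characters, with polynomial coefficients: the   *)
(* operator [phi |-> (A |-> phi (A B) - X_i(B) phi A)] lowers the degree of   *)
(* the coefficient of [X_i] and is injective on the coefficient of [X0].      *)
Lemma character_polynomial_independence (I : eqType) (s : seq I)
    (X0 phi0 : 'M[F]_m -> F) (X phi : I -> 'M[F]_m -> F) :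
    character_on X0 -> polynomial_on phi0 ->
    (forall i, i \in s -> character_on (X i)) ->
    (forall i, i \in s -> polynomial_on (phi i)) ->
    (forall i, i \in s -> exists2 B, G B & X i B != X0 B) ->
    (forall A, G A -> X0 A * phi0 A + \sum_(i <- s) X i A * phi i A = 0) ->
  forall A, G A -> phi0 A = 0.
Proof.
move=> [X0M X0n0]; elim: s phi0 phi => [|i s IHs] phi0 phi pol0 Xchar pol Xneq rel.
  move=> A GA; apply: (mulfI (X0n0 A GA)).
  by have := rel A GA; rewrite big_nil addr0 mulr0.
have [d] := pol i (mem_head i s).
have [XiM _] := Xchar i (mem_head i s).
have [B GB XB] := Xneq i (mem_head i s).
have in_s j : j \in s -> j \in i :: s by rewrite inE orbC => ->.
(* Inner induction on the degree bound of [phi i]; at bound 0 this term vanishes on [G] and the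
   outer induction on the list applies. *)
elim: d phi0 phi pol0 pol rel => [|d IHd] phi0 phi pol0 pol rel dphi.
  apply: (IHs phi0 phi) => // [j /in_s/Xchar//|j /in_s/pol//|j /in_s/Xneq//|A GA].
  by have := rel A GA; rewrite big_cons dphi // mulr0 add0r.
pose c := X i B / X0 B.
have c1 : c != 1.
  by apply: contra_neq XB => e; rewrite -[LHS](divfK (X0n0 B GB)) -/c e mul1r.
pose op (Y psi : 'M[F]_m -> F) A := Y B * psi (A *m B) - X i B * psi A.
have op_pol Y psi : polynomial_on psi -> polynomial_on (op Y psi).
  move=> ppsi; apply: (@polynomial_onD (fun A => Y B * psi (A *m B))
    (fun A => - (X i B * psi A))).
    apply: polynomial_onM (polynomial_on_cst _) _; exact: polynomial_on_shift.
  have := polynomial_onM (polynomial_on_cst (- X i B)) ppsi.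
  by apply: eq_polynomial_on => A _; rewrite mulNr.
have := IHd (op X0 phi0) (fun j => op (X j) (phi j)) (op_pol _ _ pol0).
move=> /(_ (fun j js => op_pol _ _ (pol j js))) H.
have op0 : forall A, G A -> op X0 phi0 A = 0.
  apply: H => [A GA|].
    (* The new relation is the old one at [A *m B] minus [X i B] times the old one at [A]. *)
    have relA := rel A GA; have := rel _ (GM GA GB).
    rewrite X0M // -mulrA => relAB.
    have : 0 - X i B * 0 = 0 :> F by rewrite mulr0 subrr.
    rewrite -[X in X - _ = 0]relAB -[X in _ - _ * X = 0]relA mulrDr mulr_sumr.
    rewrite opprD addrACA -sumrB => e; rewrite -[RHS]e; congr (_ + _).
      by rewrite /op; ring.
    apply: eq_big_seq => j js; rewrite /op.
    by have [XjM _] := Xchar j js; rewrite XjM //; ring.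
  suff : degree_lt d (fun A => X i B * (phi i (A *m B) - phi i A)).
    by apply: eq_degree_lt => A _; rewrite /op; ring.
  exact/degree_ltZ/dphi.
(* The vanishing of [op X0 phi0] says that translation by [B] multiplies [phi0] by [c], and [c]
   differs from 1. *)
apply: (polynomial_on_eigen pol0 GB c1) => A GA.
apply: (mulfI (X0n0 B GB)); have /eqP := op0 A GA.
rewrite subr_eq0 => /eqP ->; rewrite /c mulrA [X0 B * _]mulrC divfK //.
exact: X0n0.
Qed.

(** Induction on the degree of [Q]. Differentiating the relation in the direction [Phi B] gives a
    linear relation among the values [Phi i B], so linear independence makes each partial derivative
    satisfy the hypothesis. These derivatives vanish by induction; [Q] is then constant, and its
    value at the identity is 0. *)
Lemma additive_algebraic_independence k (alpha : 'I_k -> F)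
    (Phi : 'I_k -> 'M[F]_m -> F) (Q : {mpoly F[k]}) :
    (forall i A B, G A -> G B -> Phi i (A *m B) = Phi i A + Phi i B) ->
    (forall c : 'I_k -> F,
       (forall A, G A -> \sum_i c i * Phi i A = 0) -> forall i, c i = 0) ->
    (forall A, G A -> Q.@[fun i => alpha i + Phi i A] = 0) ->
  Q = 0.
Proof.
move=> PhiD Phifree.
have [d] : exists d, forall a, (d <= mdeg a)%N -> Q@_a = 0.
  by exists (msize Q) => a le_a; apply: memN_msupp_eq0; apply: msize_mdeg_ge.
elim: d Q => [|d IH] Q Qdeg Q0; first by apply/mpolyP => a; rewrite Qdeg // mcoeff0.
have dQ i : mderiv i Q = 0.
  apply: IH => [a le_a|A GA].
    by rewrite mcoeff_deriv Qdeg ?mul0rn // mdegD mdeg1 addn1.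
  move: i; apply: Phifree => B GB.
  pose line (P : {mpoly F[k]}) : {poly F} :=
    mmap polyC (fun i => (alpha i + Phi i A)%:P + Phi i B *: 'X) P.
  have lineE P t : (line P).[t] = P.@[fun i => alpha i + Phi i A + t * Phi i B].
    rewrite /line /mmap horner_sum mevalE; apply: eq_bigr => a _.
    rewrite hornerM hornerC /mmap1 horner_prod; congr (_ * _).
    by apply: eq_bigr => i _; rewrite horner_exp !hornerE mulrC.
  have lineM : {morph line : P P' / P * P'} by apply: rmorphM.
  (* This is the chain rule along the line, checked on constants, variables, sums and products. *)
  have deriv_line P : (line P)^`() = \sum_i Phi i B *: line (mderiv i P).
    have deriv_lineM P1 P2 :
        (line P1)^`() = \sum_i Phi i B *: line (mderiv i P1) ->
        (line P2)^`() = \sum_i Phi i B *: line (mderiv i P2) ->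
        (line (P1 * P2))^`() = \sum_i Phi i B *: line (mderiv i (P1 * P2)).
      move=> e1 e2; rewrite lineM derivM e1 e2 mulr_suml mulr_sumr -big_split.
      apply: eq_bigr => i _ /=; rewrite mderivM [line (_ + _)]raddfD /= -!/(line _).
      by rewrite !lineM scalerDr -scalerAl -scalerAr.
    have deriv_lineC c : (line c%:MP)^`() = \sum_i Phi i B *: line (mderiv i c%:MP).
      rewrite /line mmapC derivC big1 // => i _.
      by rewrite mderivC raddf0 scaler0.
    elim/mpolyind: P => [|c a P _ _ IHP]; first exact: (deriv_lineC 0).
    rewrite [line _]raddfD derivD -!/(line _) IHP -mul_mpolyC deriv_lineM //.
      rewrite -big_split; apply: eq_bigr => i _.
      by rewrite /= mderivD [in RHS]/line [in RHS]raddfD scalerDr.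
    suff deriv_prod (r : seq 'I_k) : (line (\prod_(i <- r) 'X_i ^+ a i))^`() =
        \sum_i Phi i B *: line (mderiv i (\prod_(j <- r) 'X_j ^+ a j)).
      by rewrite mpolyXE_id deriv_prod.
    elim: r => [|i r IHr].
      by rewrite big_nil -mpolyC1; exact: (deriv_lineC).
    rewrite big_cons; apply: (deriv_lineM) => //.
    elim: (a i) => [|b IHb]; first by rewrite expr0 -mpolyC1; exact: (deriv_lineC).
    rewrite exprS; apply: (deriv_lineM) => //; rewrite /line mmapX mmap1U.
    rewrite derivD derivC add0r derivZ derivX (bigD1 i) //= mderivX big1 => [|j nj].
      by rewrite mnm1E eqxx scale1r addr0 -{1}[U_(i)%MM]addm0 addmC addmK mpolyX0 -mpolyC1 mmapC.
    by rewrite mderivX mnm1E eq_sym (negbTE nj) scale0r raddf0 scaler0.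
  have line0 : line Q = 0.
    (* The point of the line at a natural parameter [j] is attained on [G], by [A] times the [j]-th
       power of [B]. *)
    apply: poly_natr_roots => j; rewrite lineE.
    have [C GC eC] : exists2 C, G C & forall i, Phi i C = Phi i A + j%:R * Phi i B.
      elim: j => [|j [C GC eC]]; first by exists A => // i; rewrite mul0r addr0.
      exists (C *m B); first exact: GM.
      by move=> i; rewrite PhiD // eC -natr1; ring.
    by rewrite -[RHS](Q0 C GC); apply: meval_eq => i; rewrite eC addrA.
  have := deriv_line Q; rewrite line0 deriv0 => /(congr1 (horner^~ 0)).
  rewrite horner0 horner_sum => e; rewrite [RHS]e; apply: eq_bigr => i _.
  rewrite hornerZ lineE mulrC; congr (_ * _).
  by apply: meval_eq => l; rewrite mul0r addr0.
have Qconst : Q = (Q@_0)%:MP.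
  apply/mpolyP => a; rewrite mcoeffC; have [->|a0] := eqVneq a 0%MM.
    by rewrite mulr1.
  rewrite mulr0.
  have [i ai] : exists i, a i != 0%N.
    apply: contrapT => nai; case/eqP: a0; apply/mnmP => i; rewrite mnm0E.
    by apply/eqP; apply: contraT => ai; case: nai; exists i.
  (* Here the coefficient of the derivative is [Q@_a] times the positive integer [a i], which is
     invertible in characteristic zero. *)
  have := mcoeff_deriv i (a - U_(i))%MM Q; rewrite dQ mcoeff0.
  rewrite submK ?lep1mP // => /esym/eqP; rewrite -mulr_natr mulf_eq0 pnatr_eq0.
  by rewrite orbF => /eqP.
by have := Q0 _ G1; rewrite Qconst mevalC => ->; rewrite mpolyC0.
Qed.

End GroupFunctions.

(** * Relative and additive invariants *)

Section RelativeInvariants.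
Variables (F : numClosedFieldType) (m n : nat).
Variables (G : set 'M[F]_m) (rho : 'M[F]_m -> 'M[F]_n).
Variables (Omega : set 'cV[F]_n) (v0 : 'cV[F]_n).
Hypotheses (hgrp : mx_group G) (hrep : rational_representation G rho).
Hypotheses (Oopen : zariski_open Omega).
Hypotheses (Oorb : exists w, Omega = orbit_of G rho w) (Ov0 : Omega v0).
Implicit Types (A B : 'M[F]_m) (p g h : {mpoly F[n]}) (v : 'cV[F]_n).

(** [rational_value] admits any representative [p / q]. From [h * q = p * g] and coprimality, [g]
    divides [q], so [g] is nonzero wherever [q] is. *)
Lemma lowest_terms_value h g v c : lowest_terms h g ->
  rational_value (tofrac h / tofrac g) v c ->
  peval g v != 0 /\ c = peval h v / peval g v.
Proof.
move=> [g0 cop] [p [q [e qv ->]]].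
have q0 : q != 0 by apply: contra_neq qv => ->; rewrite -mpolyC0 pevalC.
have epq : h * q = p * g.
  apply/eqP; rewrite -tofrac_eq !tofracM -eqr_div ?tofrac_eq0 //.
  exact/eqP.
have [c' ec'] : divides g q.
  apply: (coprime_divides (@mpoly_irreducibles_prime F n) (@mpoly_atomic F n)
            g0 cop).
  by exists p.
have gv : peval g v != 0.
  by apply: contra_neq qv => gv; rewrite ec' pevalM gv mulr0.
split=> //; apply/eqP; rewrite eqr_div // -!pevalM epq.
by [].
Qed.

Lemma additive_invariant_transform h g Phi : lowest_terms h g ->
    additive_relative_invariant G rho Omega (tofrac h / tofrac g) Phi ->
  peval g v0 != 0 /\ exists2 chi, semi_invariant G rho g chi &
    forall A, G A -> forall v,
      peval h (rho A *m v) = chi A * (peval h v + Phi A * peval g v).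
Proof.
move=> low [_ hinv]; have [g0 cop] := low.
have gv v : Omega v -> peval g v != 0.
  move=> Ov; have [a [b [_ bv _]]] := hinv v _ Ov (group_one hgrp).
  by have [] := lowest_terms_value low bv.
have transform A : G A ->
    mx_comp h (rho A) * g = (h + Phi A *: g) * mx_comp g (rho A).
  move=> GA; apply/eqP; rewrite -subr_eq0; apply/eqP.
  apply: (zariski_open_dense Oopen Ov0) => v Ov.
  have OAv : Omega (rho A *m v) by apply/(orbit_stable hgrp hrep).
  have [a [b [/(lowest_terms_value low)[gA ea] /(lowest_terms_value low)[_ eb] eab]]] :=
    hinv v A Ov GA.
  apply/eqP; rewrite /peval mevalB subr_eq0 -!/(peval _ _) !pevalM pevalD pevalZ.
  rewrite !peval_mx_comp -eab ea eb; apply/eqP.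
  by field; rewrite gA gv.
have semi : semi_invariant G rho g (fun A => peval g (rho A *m v0) / peval g v0).
  apply: (semi_invariant_intro hgrp hrep) => [|A GA]; first exact: gv.
  apply: (coprime_divides (@mpoly_irreducibles_prime F n) (@mpoly_atomic F n)
            g0 (h := h + Phi A *: g)); last by exists (mx_comp h (rho A)); rewrite transform.
  (* A common divisor of [h + Phi A *: g] and [g] also divides [h]. *)
  move=> d a b eh eg; apply: (cop d (a - Phi A *: b) b) => //.
  by rewrite mulrBr -eh -scalerAr -eg addrK.
split; first exact: gv.
eexists; first exact: semi.
move=> A GA v /=; set c := peval g _ / peval g _.
suff e : mx_comp h (rho A) = c *: (h + Phi A *: g).
  by rewrite -peval_mx_comp e pevalZ pevalD pevalZ.
apply: (mulIf g0); rewrite transform // -scalerAl scalerAr; congr (_ * _).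
by apply: peval_inj => w; rewrite peval_mx_comp pevalZ semi.
Qed.

Lemma semi_invariant_character p chi : peval p v0 != 0 ->
  semi_invariant G rho p chi -> character_on G chi.
Proof.
move=> pv0 pchi.
have p0 : p != 0 by apply: contra_neq pv0 => ->; rewrite -mpolyC0 pevalC.
split=> [A B|A GA]; first exact: (semi_invariantM hgrp hrep p0 pchi).
have e := semi_invariantM hgrp hrep p0 pchi GA (groupVx hgrp GA).
have : chi 1%:M != 0 by rewrite (semi_invariant1 hgrp hrep p0 pchi) oner_neq0.
by rewrite -(mulmxV (group_unit hgrp GA)) e mulf_eq0 => /norP[].
Qed.

Lemma semi_invariant_isotropy p chi v : peval p v != 0 ->
  semi_invariant G rho p chi -> invariant_under rho p (isotropy G rho v).
Proof.
move=> pv pchi A [GA eA] w.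
rewrite pchi // (_ : chi A = 1) ?mul1r //; apply: (mulIf pv).
by rewrite -pchi // eA mul1r.
Qed.

Lemma semi_invariant_commutator p chi A B : peval p v0 != 0 ->
  semi_invariant G rho p chi -> G A -> G B ->
  chi (invmx A *m invmx B *m A *m B) = 1.
Proof.
move=> pv0 pchi GA GB; have [chiM chi0] := semi_invariant_character pv0 pchi.
have GVA := groupVx hgrp GA; have GVB := groupVx hgrp GB.
have p0 : p != 0 by apply: contra_neq pv0 => ->; rewrite -mpolyC0 pevalC.
have chiV C : G C -> chi (invmx C) = (chi C)^-1.
  move=> GC; apply: (mulfI (chi0 C GC)); rewrite mulfV ?chi0 //.
  rewrite -chiM //; last exact: groupVx.
  by rewrite mulmxV ?(semi_invariant1 hgrp hrep p0 pchi) //; apply: (group_unit hgrp).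
have GM := groupMx hgrp.
have GC := GM _ _ GVA GVB; have GD := GM _ _ GC GA.
rewrite !chiM // !chiV //.
by field; rewrite !chi0.
Qed.

(* The zero sets of the [f_i] detect the exponents of a monomial: after       *)
(* cancelling [f_i], only one side still vanishes at [vf i].                  *)
Lemma character_exponents_inj r (f : r.-tuple {mpoly F[n]})
    (chi : 'I_r -> 'M[F]_m -> F) (vf : 'I_r -> 'cV[F]_n) (a b : 'I_r -> nat) :
    (forall i, peval (tnth f i) v0 != 0) ->
    (forall i, semi_invariant G rho (tnth f i) (chi i)) ->
    (forall i, zero_set (tnth f i) (vf i)) ->
    (forall i j, j != i -> ~ zero_set (tnth f j) (vf i)) ->
    (forall A, G A -> \prod_i chi i A ^+ a i = \prod_i chi i A ^+ b i) ->
  forall i, a i = b i.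
Proof.
move=> fv0 fchi vf1 vf2.
pose mono (a : 'I_r -> nat) := \prod_i tnth f i ^+ a i.
have monoE a' v : peval (mono a') v = \prod_i peval (tnth f i) v ^+ a' i.
  by rewrite /peval rmorph_prod; apply: eq_bigr => i _; rewrite rmorphXn.
have mono0 a' : peval (mono a') v0 != 0.
  by rewrite monoE; apply/prodf_neq0 => i _; rewrite expf_neq0.
suff le_exp a' b' : (forall A, G A -> \prod_i chi i A ^+ a' i = \prod_i chi i A ^+ b' i) ->
    forall i, (a' i <= b' i)%N.
  by move=> e i; apply/eqP; rewrite eqn_leq !le_exp // => A GA; rewrite e.
move=> e i; rewrite leqNgt; apply/negP => lt_i.
(* Equal characters make the two monomials proportional on the orbit of [v0]; density extends this
   to the whole space. *)
have emono : peval (mono b') v0 *: mono a' = peval (mono a') v0 *: mono b'.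
  apply/eqP; rewrite -subr_eq0; apply/eqP.
  apply: (zariski_open_dense Oopen Ov0) => v Ov.
  have [A GA ->] := orbit_transitive hgrp hrep Oorb Ov0 Ov.
  have monoA c : peval (mono c) (rho A *m v0) =
      (\prod_i chi i A ^+ c i) * peval (mono c) v0.
    rewrite !monoE -big_split; apply: eq_bigr => j _.
    by rewrite fchi // exprMn.
  rewrite /peval mevalB -!/(peval _ _) !pevalZ !monoA e //; ring.
have fi0 : tnth f i != 0.
  by apply: contra_neq (fv0 i) => ->; rewrite -mpolyC0 pevalC.
pose others (c : 'I_r -> nat) := \prod_(j < r | j != i) tnth f j ^+ c j.
have monoD c : mono c = tnth f i ^+ c i * others c.
  by rewrite /mono (bigD1 i).
have : peval (mono b') v0 *: (tnth f i ^+ (a' i - b' i) * others a') =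
       peval (mono a') v0 *: others b'.
  apply: (mulfI (expf_neq0 (b' i) fi0)); rewrite -!scalerAr mulrA -exprD.
  by rewrite subnKC ?(ltnW lt_i) // -!monoD.
move/(congr1 (fun q => peval q (vf i))).
rewrite !pevalZ pevalM; have -> : peval (tnth f i ^+ (a' i - b' i)) (vf i) = 0.
  rewrite /peval rmorphXn -/(peval _ _) /= -/(peval _ _).
  by rewrite (vf1 i : peval _ _ = 0) expr0n subn_eq0 leqNgt lt_i.
move/esym/eqP; rewrite mul0r mulr0 mulf_eq0 (negbTE (mono0 _)) /=.
rewrite /peval rmorph_prod => /prodf_eq0[j nji].
rewrite rmorphXn expf_eq0 => /andP[_ /eqP fj].
exact: (vf2 i j nji).
Qed.

End RelativeInvariants.

(** * Algebraic independence of the invariants *)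

Section AlgebraicIndependence.
Variables (F : numClosedFieldType) (m n r s : nat).
Variables (G : set 'M[F]_m) (rho : 'M[F]_m -> 'M[F]_n).
Variables (Omega : set 'cV[F]_n) (v0 : 'cV[F]_n).
Hypotheses (hgrp : mx_group G) (hrep : rational_representation G rho).
Hypotheses (Oopen : zariski_open Omega).
Hypotheses (Oorb : exists w, Omega = orbit_of G rho w) (Ov0 : Omega v0).
Variables (f : r.-tuple {mpoly F[n]}) (h g : s.-tuple {mpoly F[n]}).
Variables (chif : 'I_r -> 'M[F]_m -> F) (chig Phi : 'I_s -> 'M[F]_m -> F).
Variable vf : 'I_r -> 'cV[F]_n.
Hypotheses (fv0 : forall i, peval (tnth f i) v0 != 0)
  (fchi : forall i, semi_invariant G rho (tnth f i) (chif i))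
  (vf1 : forall i, zero_set (tnth f i) (vf i))
  (vf2 : forall i j, j != i -> ~ zero_set (tnth f j) (vf i)).
Hypotheses (gv0 : forall j, peval (tnth g j) v0 != 0)
  (gchi : forall j, semi_invariant G rho (tnth g j) (chig j))
  (hchi : forall j A, G A -> forall v, peval (tnth h j) (rho A *m v) =
     chig j A * (peval (tnth h j) v + Phi j A * peval (tnth g j) v)).
Hypotheses (PhiD : forall j A B, G A -> G B -> Phi j (A *m B) = Phi j A + Phi j B)
  (Phifree : forall c : 'I_s -> F,
     (forall A, G A -> \sum_j c j * Phi j A = 0) -> forall j, c j = 0).

Let GM := groupMx hgrp.
Let G1 := group_one hgrp.

(* On the orbit of [v0], each monomial in the [f_i] and [h_j] is a character  *)
(* of [G] times a polynomial in the additive functions.                       *)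
Lemma semi_invariants_algebraically_independent :
  algebraically_independent [tuple of f ++ h].
Proof.
move=> P P0; apply/mpolyP => M0; rewrite mcoeff0; apply/eqP; apply: contraT => PM0.
(* By [hchi], the value of [h_j] at [rho A *m v0] is [chig j A * L j A]. Thus the monomial [M] of
   [P], with its coefficient, contributes [X M A * phi M A]. *)
pose L j A := peval (tnth h j) v0 + Phi j A * peval (tnth g j) v0.
pose X (M : 'X_{1..r + s}) A :=
  (\prod_i chif i A ^+ M (lshift s i)) * \prod_j chig j A ^+ M (rshift r j).
pose C (M : 'X_{1..r + s}) := P@_M * \prod_i peval (tnth f i) v0 ^+ M (lshift s i).
pose bM (M : 'X_{1..r + s}) : 'X_{1..s} := [multinom M (rshift r j) | j < s].
pose phi (M : 'X_{1..r + s}) A := (C M *: 'X_[bM M]).@[L^~ A].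
have Lpol j : polynomial_on G (L j).
  apply: (polynomial_onD GM (polynomial_on_cst _ _)).
  apply: (polynomial_onM GM _ (polynomial_on_cst _ _)).
  exact/(polynomial_on_additive GM)/PhiD.
have chifP i := semi_invariant_character hgrp hrep (fv0 i) (fchi i).
have chigP j := semi_invariant_character hgrp hrep (gv0 j) (gchi j).
have chigX0 M A : G A -> \prod_j chig j A ^+ M (rshift r j) != 0 :> F.
  by move=> GA; apply/prodf_neq0 => j _; rewrite expf_neq0 //; apply: (chigP j).2.
have Xchar M : character_on G (X M).
  split=> [A B GA GB|A GA].
    rewrite /X mulrACA -!big_split; congr (_ * _); apply: eq_bigr => i _ /=.
      by rewrite (chifP i).1 // exprMn.
    by rewrite (chigP i).1 // exprMn.
  rewrite mulf_neq0 ?chigX0 //; apply/prodf_neq0 => i _.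
  by rewrite expf_neq0 //; apply: (chifP i).2.
have rel A : G A -> \sum_(M <- msupp P) X M A * phi M A = 0.
  move=> GA; have := congr1 (fun q => peval q (rho A *m v0)) P0.
  rewrite /= -mpolyC0 pevalC => e.
  rewrite -[RHS]e /peval comp_mpoly_meval mevalE.
  apply: eq_bigr => M _; rewrite big_split_ord /=.
  have -> : \prod_(i < r) (tnth [tuple of f ++ h] (lshift s i)).@[fun k => (rho A *m v0) k ord0]
        ^+ M (lshift s i) =
      \prod_i chif i A ^+ M (lshift s i) * \prod_i peval (tnth f i) v0 ^+ M (lshift s i).
    rewrite -big_split; apply: eq_bigr => i _.
    by rewrite tnth_lshift -/(peval _ _) fchi // exprMn.
  have -> : \prod_(j < s) (tnth [tuple of f ++ h] (rshift r j)).@[fun k => (rho A *m v0) k ord0]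
        ^+ M (rshift r j) =
      \prod_j chig j A ^+ M (rshift r j) * \prod_j L j A ^+ M (rshift r j).
    rewrite -big_split; apply: eq_bigr => j _.
    by rewrite tnth_rshift -/(peval _ _) hchi // exprMn.
  have -> : phi M A = C M * \prod_j L j A ^+ M (rshift r j).
    by rewrite /phi mevalZ mevalX; congr (_ * _); apply: eq_bigr => j _; rewrite mnmE.
  rewrite /X /C; ring.
pose same M := `[< forall A, G A -> X M A = X M0 A >].
(* [Q] gathers the terms whose character is that of [M0]. Independence of characters makes it vanish
   along the [L j]. These are shifts of additive functions, still linearly independent after
   rescaling by the nonzero values [g_j(v0)], so [Q] is zero. *)
pose Q := \sum_(M <- msupp P | same M) C M *: 'X_[bM M].
have QE A : Q.@[L^~ A] = \sum_(M <- msupp P | same M) phi M A.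
  by rewrite /Q raddf_sum.
have Q0 : Q = 0.
  apply: (@additive_algebraic_independence _ _ G G1 GM s
    (fun j => peval (tnth h j) v0) (fun j A => Phi j A * peval (tnth g j) v0)).
  - by move=> j A B GA GB; rewrite PhiD // mulrDl.
  - move=> c c0 j; have := Phifree (c := fun j => c j * peval (tnth g j) v0) _ j.
    move=> /(_ _)/eqP; rewrite mulf_eq0 (negbTE (gv0 j)) orbF => H; apply/eqP/H.
    by move=> A GA; rewrite -[RHS](c0 A GA); apply: eq_bigr => l _; ring.
  - apply: (@character_polynomial_independence _ _ G GM _
      [seq M <- msupp P | ~~ same M] (X M0) _ X phi) => //.
    + exact: (polynomial_on_meval GM).
    + by move=> M _; apply: (polynomial_on_meval GM).
    + move=> M; rewrite mem_filter => /andP[/asboolPn nsame _].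
      apply: contrapT => nB; apply: nsame => A GA; apply/eqP.
      by apply: contraT => XA; case: nB; exists A.
    + move=> A GA; rewrite -[RHS](rel A GA) [RHS](bigID same) big_filter /=.
      congr (_ + _); rewrite -/(L^~ A) QE mulr_sumr; apply: eq_bigr => M.
      by move=> /asboolP->.
have same0 : same M0 by apply/asboolP.
(* Equal exponents in the [h_j] cancel the [chig] factors, and the remaining characters determine
   the exponents in the [f_i]. Hence the coefficient of [Q] at [bM M0] is the single nonzero term
   [C M0]. *)
have inj M : same M -> bM M = bM M0 -> M = M0.
  move=> /asboolP XM ebM.
  have bE j : M (rshift r j) = M0 (rshift r j).
    by have /mnmP/(_ j) := ebM; rewrite !mnmE.
  have aE := character_exponents_inj hgrp hrep Oopen Oorb Ov0 fv0 fchi vf1 vf2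
    (a := fun i => M (lshift s i)) (b := fun i => M0 (lshift s i)) _.
  apply/mnmP => k; case: (splitP k) => [i|j] ek.
    rewrite (_ : k = lshift s i) ?aE //; last exact: val_inj.
    move=> A GA; apply: (mulIf (chigX0 M0 A GA)).
    rewrite -[RHS](XM A GA) /X; congr (_ * _).
    by apply: eq_bigr => j _; rewrite bE.
  by rewrite (_ : k = rshift r j) ?bE //; apply: val_inj.
have := congr1 (mcoeff (bM M0)) Q0; rewrite mcoeff0 /Q raddf_sum /=.
rewrite -big_filter (bigD1_seq M0) ?filter_uniq ?msupp_uniq //=; last first.
  by rewrite mem_filter same0 mcoeff_msupp.
rewrite mcoeffZ mcoeffX eqxx mulr1 big1_seq ?addr0 => [/eqP|M /andP[nM]].
  rewrite mulf_eq0 (negbTE PM0) /= => /prodf_eq0[i _].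
  by rewrite expf_eq0 (negbTE (fv0 i)) andbF.
rewrite mem_filter => /andP[sM _]; rewrite mcoeffZ mcoeffX.
case: eqP => [/(inj M sM) eM|_]; last by rewrite mulr0.
by rewrite eM eqxx in nM.
Qed.

End AlgebraicIndependence.

(** Algebraic closure serves the Nullstellensatz, and characteristic zero serves the density and
    differentiation arguments; [R[i]] provides both. *)
Lemma prehomogeneous_invariants (F : numClosedFieldType) (m n r s : nat)
    (G : set 'M[F]_m) (rho : 'M[F]_m -> 'M[F]_n)
    (Omega : set 'cV[F]_n) (v0 : 'cV[F]_n)
    (f : r.-tuple {mpoly F[n]}) (Phi : 'I_s -> 'M[F]_m -> F)
    (h g : s.-tuple {mpoly F[n]}) (v : 'I_r -> 'cV[F]_n) :
    prehomogeneous G rho -> open_orbit G rho Omega -> Omega v0 ->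
    basic_relative_invariants Omega f ->
    function_basis G (corresponding_additive_functions G rho Omega) Phi ->
    (forall i, lowest_terms (tnth h i) (tnth g i)) ->
    (forall i, additive_relative_invariant G rho Omega
       (tofrac (tnth h i) / tofrac (tnth g i)) (Phi i)) ->
    (forall i, zero_set (tnth f i) (v i)) ->
    (forall i j, j != i -> ~ zero_set (tnth f j) (v i)) ->
  [/\ forall i,
        invariant_under rho (tnth f i)
          (mx_setmul (derived_group G) (isotropy G rho v0)) /\
        forall j, j != i ->
          invariant_under rho (tnth f i) (isotropy G rho (v j)),
      forall i,
        invariant_under rho (tnth h i)
          (mx_setmul (derived_group G) (isotropy G rho v0)) /\
        forall j, peval (tnth g i) (v j) != 0 ->
          invariant_under rho (tnth h i) (isotropy G rho (v j))
    & algebraically_independent [tuple of f ++ h]].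
Proof.
move=> [[hgrp _] Gconn hrep _] [Oopen Oorb] Ov0 hf [_ Phifree _] low hinv vf1 vf2.
have [firr fcomp _ _] := hf.
have fv0 i : peval (tnth f i) v0 != 0.
  by apply/eqP => fv; have [/(_ v0 fv)] := fcomp i.
have stable := connected_stabilizes_component hgrp hrep Gconn Oorb hf vf1 vf2.
pose chif i A := peval (tnth f i) (rho A *m v0) / peval (tnth f i) v0.
have fchi i : semi_invariant G rho (tnth f i) (chif i).
  apply: (semi_invariant_intro hgrp hrep (fv0 i)) => A GA.
  (* Since [rho A] preserves [V(f_i)], the transformed [f_i] vanishes on [V(f_i)] and is therefore
     divisible by [f_i]. *)
  apply: irreducible_nullstellensatz => [|x fx]; first exact: firr.
  have := stable A GA i (\col_j x j); rewrite /zero_set /= -peval_mx_comp.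
  rewrite /peval; under meval_eq do rewrite mxE; move=> /(_ fx) <-.
  by apply: meval_eq => j; rewrite mxE.
pose T i := additive_invariant_transform hgrp hrep Oopen Oorb Ov0 (low i) (hinv i).
have gv0 i : peval (tnth g i) v0 != 0 := (T i).1.
have /choice[chig gchi] : forall i, exists chi, semi_invariant G rho (tnth g i) chi /\
    forall A, G A -> forall v,
      peval (tnth h i) (rho A *m v) =
      chi A * (peval (tnth h i) v + Phi i A * peval (tnth g i) v).
  by move=> i; have [_ [chi]] := T i; exists chi.
have PhiD i A B : G A -> G B -> Phi i (A *m B) = Phi i A + Phi i B.
  by have [[_ +] _] := hinv i; apply.
(* At a fixed point [w] with [g_i(w)] nonzero, the transformation of [g_i] forces [chig i A = 1];
   that of [h_i] then forces [Phi i A = 0]. *)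
have h_isotropy i w : peval (tnth g i) w != 0 ->
    invariant_under rho (tnth h i) (isotropy G rho w).
  move=> gw A [GA eA] x; have [gi hi] := gchi i.
  have c1 : chig i A = 1 by apply: (mulIf gw); rewrite -gi // eA mul1r.
  have : peval (tnth h i) w = peval (tnth h i) w + Phi i A * peval (tnth g i) w.
    by rewrite -[RHS]mul1r -c1 -hi // eA.
  move/eqP; rewrite -subr_eq0 opprD addNKr oppr_eq0 mulf_eq0 (negbTE gw) orbF.
  by move=> /eqP Phi0; rewrite hi // c1 Phi0 mul0r addr0 mul1r.
have isoG w : isotropy G rho w `<=` G by move=> A [].
split.
- move=> i; split=> [|j nji].
    have [|inv sub] := invariant_derived hgrp hrep (p := tnth f i).
      move=> A B GA GB x; rewrite fchi; last by do !apply: groupMx => //; apply: groupVx.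
      by rewrite (semi_invariant_commutator hgrp hrep (fv0 i)) ?mul1r.
    apply: (invariant_setmul hrep) => //.
    exact: (semi_invariant_isotropy (fv0 i) (fchi i)).
  apply: semi_invariant_isotropy (fchi i); apply/eqP.
  by apply: vf2; rewrite eq_sym.
- move=> i; split=> [|j gv]; last exact: h_isotropy.
  have [gi hi] := gchi i.
  have [|inv sub] := invariant_derived hgrp hrep (p := tnth h i).
    move=> A B GA GB x.
    have GVA := groupVx hgrp GA; have GVB := groupVx hgrp GB.
    have GC := groupMx hgrp GVA GVB; have GD := groupMx hgrp GC GA.
    have Phi1 : Phi i 1%:M = 0.
      have := PhiD i _ _ (group_one hgrp) (group_one hgrp).
      by rewrite mulmx1 => /esym/eqP; rewrite -subr_eq0 addrK => /eqP.
    have PhiV C : G C -> Phi i (invmx C) = - Phi i C.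
      move=> GC'; apply/eqP; rewrite -addr_eq0 -PhiD ?mulVmx ?Phi1 //.
        exact: (group_unit hgrp).
      exact: groupVx.
    rewrite hi; last exact: groupMx.
    rewrite (semi_invariant_commutator hgrp hrep (gv0 i) gi) // !PhiD // !PhiV //.
    by ring.
  by apply: (invariant_setmul hrep) => //; apply: h_isotropy.
- exact: (semi_invariants_algebraically_independent hgrp hrep Oopen Oorb Ov0 fv0
    fchi vf1 vf2 gv0 (fun j => (gchi j).1) (fun j => (gchi j).2) PhiD Phifree).
Qed.

Theorem proposition3p14 (R : realType) (m n r s : nat)
    (G : set 'M[R[i]]_m) (rho : 'M[R[i]]_m -> 'M[R[i]]_n)
    (Omega : set 'cV[R[i]]_n) (v0 : 'cV[R[i]]_n)
    (f : r.-tuple {mpoly R[i][n]})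
    (Phi : 'I_s -> 'M[R[i]]_m -> R[i])
    (h g : s.-tuple {mpoly R[i][n]})
    (v : 'I_r -> 'cV[R[i]]_n)
    (hG : prehomogeneous G rho)
    (hOmega : open_orbit G rho Omega)
    (hv0 : Omega v0)
    (hf : basic_relative_invariants Omega f)
    (hPhi : function_basis G (corresponding_additive_functions G rho Omega) Phi)
    (hgh : forall i, lowest_terms (tnth h i) (tnth g i))
    (hinv : forall i,
       additive_relative_invariant G rho Omega
         (tofrac (tnth h i) / tofrac (tnth g i)) (Phi i))
    (hv : forall i, zero_set (tnth f i) (v i))
    (hv' : forall i j, j != i -> ~ zero_set (tnth f j) (v i)) :
  [/\ forall i,
        invariant_under rho (tnth f i)
          (mx_setmul (derived_group G) (isotropy G rho v0)) /\
        forall j, j != i ->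
          invariant_under rho (tnth f i) (isotropy G rho (v j)),
      forall i,
        invariant_under rho (tnth h i)
          (mx_setmul (derived_group G) (isotropy G rho v0)) /\
        forall j, peval (tnth g i) (v j) != 0 ->
          invariant_under rho (tnth h i) (isotropy G rho (v j))
    & algebraically_independent [tuple of f ++ h]].
Proof. exact: (prehomogeneous_invariants hG hOmega hv0 hf hPhi hgh hinv hv hv'). Qed.
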